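(* For a field $F$, the following are equivalent. (i) $\mathrm{Th}_{\exists}(F)=\mathrm{Th}_{\exists}(F(\!(t)\!))$. (ii) $\mathrm{Th}_{\exists}(F)=\mathbf{H}^{e\prime}(\mathrm{Th}(F))_{\mathrm{E}}$. (iii) $\mathrm{Th}_{\exists}(F)=\mathbf{H}^{e\prime}(\mathrm{Th}_{\exists}(F))_{\mathrm{E}}$. (iv) $\mathrm{Th}_{\exists}(F)$ is a fixed point of the map $T\mapsto \mathbf{H}^{e\prime}(T)_{\mathrm{E}}$ from the power set of $\mathrm{E}$ to itself. (v) There exists a henselian field $F'$ such that $\mathrm{Th}_{\exists}(F)=\mathrm{Th}_{\exists}(F')$. (vi) $F$ is $\mathbb{Z}$-large. (vii) The class of fields $\{F' \mid \mathrm{Th}_{\exists}(F)=\mathrm{Th}_{\exists}(F')\}$ is $\mathbb{Z}$-large.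
   Context: $\mathfrak{L}_{\mathrm{ring}}$ is the language of rings and $\mathfrak{L}_{\mathrm{val}}$ the language of valued fields (e.g. $\mathfrak{L}_{\mathrm{ring}}$ together with a unary predicate for the valuation ring). An existential sentence is one of the form $\exists x_1\ldots\exists x_n\,\psi$ with $\psi$ quantifier-free (negations allowed). $\mathrm{E}=\mathrm{Sent}_{\exists}(\mathfrak{L}_{\mathrm{ring}})$ is the set of existential $\mathfrak{L}_{\mathrm{ring}}$-sentences. For a field $F$, $\mathrm{Th}(F)$ is its full $\mathfrak{L}_{\mathrm{ring}}$-theory and $\mathrm{Th}_{\exists}(F)$ is the set of existential $\mathfrak{L}_{\mathrm{ring}}$-sentences true in $F$ (no parameters). A valuation $v$ on a field $K$ is henselian if it extends uniquely (up to equivalence) to every finite extension of $K$, and equicharacteristic if $\mathrm{char}(K)=\mathrm{char}(Kv)$, where $Kv$ is the residue field. A field is henselian if it admits a nontrivial henselian valuation. $\mathbf{H}^{e\prime}$ is the $\mathfrak{L}_{\mathrm{val}}$-theory of equicharacteristic henselian nontrivially valued fields. For an $\mathfrak{L}_{\mathrm{ring}}$-theory (set of sentences) $R$, $\mathbf{H}^{e\prime}(R)$ is the $\mathfrak{L}_{\mathrm{val}}$-theory whose models are the $(K,v)\models\mathbf{H}^{e\prime}$ with $Kv\models R$. $\mathbf{H}^{e\prime}(R)_{\mathrm{E}}$ denotes the set of sentences in $\mathrm{E}$ entailed by $\mathbf{H}^{e\prime}(R)$, i.e. the existential $\mathfrak{L}_{\mathrm{ring}}$-sentences true in $K$ for every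 $(K,v)\models\mathbf{H}^{e\prime}(R)$. A class $\mathcal{C}$ of fields is $\mathbb{Z}$-large if there exist $k_1,k_2\in\mathcal{C}$, a subfield $E\subseteq k_1$, and a nontrivial henselian valuation $v$ on $E$ with $Ev\cong k_2$. A field $k$ is $\mathbb{Z}$-large if the class $\{k'\mid k'\equiv k\}$ of fields elementarily equivalent to $k$ in $\mathfrak{L}_{\mathrm{ring}}$ is $\mathbb{Z}$-large. *)

(* Defs.v *)
From HB Require Import structures.
From mathcomp Require Import all_boot all_order all_algebra all_field.
From mathcomp Require Import fraction ring_quotient generic_quotient.
From mathcomp Require Import boolp classical_sets.

Set Implicit Arguments.
Unset Strict Implicit.
Unset Printing Implicit Defensive.

Import GRing.Theory.

Local Open Scope ring_scope.

(* First-order syntax over the language {0, 1, +, -, *}.  It is not taken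
   from GRing.formula, whose terms have parameters and inverses.  Formulas are
   indexed by the number of variables in scope, and FExists and FForall bind
   variable 0 of their body, the others being shifted up by one. *)
Inductive ring_term (n : nat) : Type :=
| TVar of 'I_n
| TZero
| TOne
| TOpp of ring_term n
| TAdd of ring_term n & ring_term n
| TMul of ring_term n & ring_term n.

Inductive ring_formula (n : nat) : Type :=
| FEq of ring_term n & ring_term n
| FNot of ring_formula n
| FAnd of ring_formula n & ring_formula n
| FOr of ring_formula n & ring_formula n
| FExists of ring_formula n.+1
| FForall of ring_formula n.+1.

Definition ring_sentence : Type := ring_formula 0.

Fixpoint eval_term (R : nzRingType) n (e : n.-tuple R) (t : ring_term n) : R :=
  match t with
  | TVar i => tnth e i
  | TZero => 0
  | TOne => 1
  | TOpp t1 => - eval_term e t1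
  | TAdd t1 t2 => eval_term e t1 + eval_term e t2
  | TMul t1 t2 => eval_term e t1 * eval_term e t2
  end.

Fixpoint holds (R : nzRingType) n (e : n.-tuple R) (f : ring_formula n) : Prop :=
  match f with
  | FEq t1 t2 => eval_term e t1 = eval_term e t2
  | FNot f1 => ~ holds e f1
  | FAnd f1 f2 => holds e f1 /\ holds e f2
  | FOr f1 f2 => holds e f1 \/ holds e f2
  | FExists f1 => exists x : R, holds [tuple of x :: e] f1
  | FForall f1 => forall x : R, holds [tuple of x :: e] f1
  end.

Definition satisfies (R : nzRingType) (phi : ring_sentence) : Prop :=
  holds [tuple of [::] : seq R] phi.

Fixpoint quantifier_free n (f : ring_formula n) : bool :=
  match f with
  | FEq _ _ => true
  | FNot f1 => quantifier_free f1
  | FAnd f1 f2 | FOr f1 f2 => quantifier_free f1 && quantifier_free f2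
  | FExists _ | FForall _ => false
  end.

Fixpoint existential n (f : ring_formula n) : bool :=
  if f is FExists f1 then existential f1 else quantifier_free f.

Definition ex_sentences : set ring_sentence := [set phi | existential phi].

Definition Th (F : fieldType) : set ring_sentence := [set phi | satisfies F phi].

Definition Th_ex (F : fieldType) : set ring_sentence :=
  (Th F `&` ex_sentences)%classic.

Definition models (F : fieldType) (T : set ring_sentence) : Prop :=
  forall phi, T phi -> satisfies F phi.

Definition elem_equiv (F F' : fieldType) : Prop :=
  forall phi, satisfies F phi <-> satisfies F' phi.

(* A valuation (of arbitrary rank) up to equivalence is given by its valuation
   ring, as in the language of rings with a predicate for the valuation ring.
   As 0^-1 = 0, the case x = 0 of the last axiom holds in any subring. *)
Record valuation_ring (K : fieldType) := ValuationRing {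
  vr_mem :> {pred K};
  vr_subring : subring_closed vr_mem;
  vr_total : forall x : K, (x \in vr_mem) || (x^-1 \in vr_mem)
}.

Section ResidueField.

Variables (K : fieldType) (v : valuation_ring K).

HB.instance Definition _ :=
  GRing.isSubringClosed.Build K (vr_mem v) (vr_subring v).

Record vr_elt : Type := VrElt { vr_val :> K; vr_valP : vr_val \in v }.

HB.instance Definition _ := [isSub for vr_val].
HB.instance Definition _ := [Choice of vr_elt by <:].
HB.instance Definition _ := [SubChoice_isSubComNzRing of vr_elt by <:].

Definition max_ideal : {pred vr_elt} :=
  [pred x : vr_elt | (vr_val x == 0) || ((vr_val x)^-1 \notin v)].

Lemma max_idealE x :
  (x \in max_ideal) = (vr_val x == 0) || ((vr_val x)^-1 \notin v).
Proof. by []. Qed.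

Lemma max_idealM (a x : vr_elt) : x \in max_ideal -> a * x \in max_ideal.
Proof.
rewrite !max_idealE; have -> : vr_val (a * x) = vr_val a * vr_val x by [].
rewrite mulf_eq0 => /orP[->|xV]; first by rewrite orbT.
have [//|a0 /=] := eqVneq (vr_val a) 0.
have [//|x0 /=] := eqVneq (vr_val x) 0.
apply: contra xV; rewrite invfM => h.
rewrite -[(vr_val x)^-1]mul1r -(divff a0) -mulrA.
by apply: rpredM => //; apply: vr_valP.
Qed.

Lemma max_idealD (x y : vr_elt) :
  x \in max_ideal -> y \in max_ideal -> x + y \in max_ideal.
Proof.
wlog xy : x y / vr_val x / vr_val y \in v => [hw|] xm ym.
  have /orP[h|h] := vr_total v (vr_val x / vr_val y); first exact: hw.
  by rewrite addrC; apply: hw => //; rewrite -[vr_val y]invrK -invfM mulrC.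
have [y0|y0] := eqVneq (vr_val y) 0.
  suff -> : y = 0 by rewrite addr0.
  by apply/val_inj; rewrite /= y0.
have -> : x + y = (1 + VrElt xy) * y.
  by apply/val_inj; rewrite /= mulrDl mul1r divfK // addrC.
exact: max_idealM.
Qed.

Lemma max_ideal_closed : idealr_closed max_ideal.
Proof.
split.
- by rewrite max_idealE eqxx.
- by rewrite max_idealE /= oner_eq0 invr1 negbK rpred1.
- by move=> a x y xm ym; apply: max_idealD => //; apply: max_idealM.
Qed.

HB.instance Definition _ := isIdealr.Build vr_elt max_ideal max_ideal_closed.

Definition residue_field : Type := {ideal_quot max_ideal}.

HB.instance Definition _ := GRing.ComNzRing.on residue_field.

Definition residue (x : vr_elt) : residue_field :=
  (\pi_({ideal_quot max_ideal}) x)%qT.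

(* the inverse in K when it lies in the valuation ring, and 0 otherwise *)
Definition vr_inv (x : vr_elt) : vr_elt := insubd (0 : vr_elt) (vr_val x)^-1.

Definition residue_inv (q : residue_field) : residue_field :=
  residue (vr_inv (repr (q : {ideal_quot max_ideal}))).

Lemma residueK (q : residue_field) :
  residue (repr (q : {ideal_quot max_ideal})) = q.
Proof. exact: reprK. Qed.

Lemma residue_eq (x y : vr_elt) :
  x - y \in max_ideal -> residue x = residue y.
Proof. by move=> h; apply/eqP; rewrite -Quotient.idealrBE. Qed.

Lemma residue_mulVf (q : residue_field) : q != 0 -> residue_inv q * q = 1.
Proof.
rewrite -{1 3}[q]residueK /residue_inv; set x := repr _ => q0.
have xm : x \notin max_ideal.
  apply: contra q0 => xm; apply/eqP.
  by rewrite (@residue_eq x 0) ?subr0 //; apply: rmorph0.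
move: xm; rewrite max_idealE negb_or negbK => /andP[x0 xV].
have <- : residue 1 = 1 by apply: rmorph1.
have <- : residue (vr_inv x * x) = residue (vr_inv x) * residue x.
  exact: rmorphM.
congr residue; apply/val_inj => /=.
by rewrite /vr_inv insubdK //= mulVf.
Qed.

Lemma residue_inv0 : residue_inv 0 = 0.
Proof.
have xm : repr (0 : {ideal_quot max_ideal}) \in max_ideal.
  by rewrite -[X in X \in _]subr0 Quotient.idealrBE reprK rmorph0.
rewrite /residue_inv; set x := repr _ in xm *.
suff -> : vr_inv x = 0 by apply: rmorph0.
move: xm; rewrite max_idealE => /orP[/eqP x0|xV].
  by apply/val_inj; rewrite /vr_inv x0 invr0 insubdK //= rpred0.
apply/val_inj; rewrite /vr_inv /insubd insubN //.
Qed.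

HB.instance Definition _ := GRing.ComNzRing_isField.Build residue_field
  residue_mulVf residue_inv0.

End ResidueField.

Definition nontrivial_vr (K : fieldType) (v : valuation_ring K) : Prop :=
  exists x : K, x \notin v.

Definition vr_extends (K : fieldType) (v : valuation_ring K)
    (L : fieldExtType K) (w : valuation_ring L) : Prop :=
  forall x : K, (x%:A \in w) = (x \in v).

Definition henselian_vr (K : fieldType) (v : valuation_ring K) : Prop :=
  forall L : fieldExtType K, exists w : valuation_ring L,
    vr_extends v w /\
    forall w' : valuation_ring L, vr_extends v w' -> w' =i w.

Definition equicharacteristic (K : fieldType) (v : valuation_ring K) : Prop :=
  [pchar K] =i [pchar (residue_field v)].

Definition henselian_field (K : fieldType) : Prop :=
  exists v : valuation_ring K, nontrivial_vr v /\ henselian_vr v.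

(* The theories H^e' and H^e'(R) are given by their models, and HeR_ex R is
   H^e'(R)_E. *)
Definition He_model (K : fieldType) (v : valuation_ring K) : Prop :=
  [/\ equicharacteristic v, henselian_vr v & nontrivial_vr v].

Definition HeR_model (R : set ring_sentence)
    (K : fieldType) (v : valuation_ring K) : Prop :=
  He_model v /\ models (residue_field v) R.

Definition HeR_ex (R : set ring_sentence) : set ring_sentence :=
  [set phi | ex_sentences phi /\
     forall (K : fieldType) (v : valuation_ring K),
       HeR_model R v -> satisfies K phi].

Definition ex_theory : Type :=
  {T : set ring_sentence | (T `<=` ex_sentences)%classic}.

Lemma Th_ex_sub (F : fieldType) : (Th_ex F `<=` ex_sentences)%classic.
Proof. by move=> phi []. Qed.

Lemma HeR_ex_sub (R : set ring_sentence) : (HeR_ex R `<=` ex_sentences)%classic.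
Proof. by move=> phi []. Qed.

Definition Th_ex_theory (F : fieldType) : ex_theory :=
  exist (fun T => T `<=` ex_sentences)%classic (Th_ex F) (@Th_ex_sub F).

Definition HeR_ex_map (T : ex_theory) : ex_theory :=
  exist (fun T => T `<=` ex_sentences)%classic (HeR_ex (sval T))
    (@HeR_ex_sub (sval T)).

Definition field_isomorphic (k k' : fieldType) : Prop :=
  exists f : {rmorphism k -> k'}, bijective f.

Definition Z_large_class (C : fieldType -> Prop) : Prop :=
  exists k1 k2 : fieldType, [/\ C k1, C k2 &
    exists (S : pred k1) (E : subFieldType S) (v : valuation_ring E),
      [/\ nontrivial_vr v, henselian_vr v &
          field_isomorphic (residue_field v) k2]].

Definition Z_large (k : fieldType) : Prop := Z_large_class (elem_equiv k).

Record power_series (R : Type) := PowerSeries { pscoef : nat -> R }.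

Section PowerSeriesRing.

Variable R : comNzRingType.
Implicit Types a b c : power_series R.

HB.instance Definition _ := gen_eqMixin (power_series R).
HB.instance Definition _ := gen_choiceMixin (power_series R).

Definition ps0 : power_series R := PowerSeries (fun=> 0).
Definition ps1 : power_series R := PowerSeries (fun n => (n == 0)%N%:R).
Definition ps_opp a := PowerSeries (fun n => - pscoef a n).
Definition ps_add a b := PowerSeries (fun n => pscoef a n + pscoef b n).
Definition ps_mul a b :=
  PowerSeries (fun n => \sum_(i < n.+1) pscoef a i * pscoef b (n - i)%N).

Lemma psP a b : pscoef a =1 pscoef b -> a = b.
Proof. by case: a b => [a] [b] /= /funext ->. Qed.

Lemma ps_addA : associative ps_add.
Proof. by move=> a b c; apply: psP => n /=; rewrite addrA. Qed.

Lemma ps_addC : commutative ps_add.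
Proof. by move=> a b; apply: psP => n /=; rewrite addrC. Qed.

Lemma ps_add0 : left_id ps0 ps_add.
Proof. by move=> a; apply: psP => n /=; rewrite add0r. Qed.

Lemma ps_addN : left_inverse ps0 ps_opp ps_add.
Proof. by move=> a; apply: psP => n /=; rewrite addNr. Qed.

HB.instance Definition _ :=
  GRing.isZmodule.Build (power_series R) ps_addA ps_addC ps_add0 ps_addN.

Definition ps_trunc N a : {poly R} := \poly_(i < N) pscoef a i.

Lemma coef_ps_truncM (N : nat) a b n :
  (n < N)%N -> (ps_trunc N a * ps_trunc N b)`_n = pscoef (ps_mul a b) n.
Proof.
move=> nN; rewrite coefM; apply: eq_bigr => i _; rewrite !coef_poly.
have iN : (i < N)%N by apply: leq_ltn_trans nN; rewrite -ltnS.
have niN : (n - i < N)%N by apply: leq_ltn_trans nN; rewrite leq_subr.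
by rewrite iN niN.
Qed.

Lemma ps_mulC : commutative ps_mul.
Proof.
by move=> a b; apply: psP => n; rewrite -!(@coef_ps_truncM n.+1) // mulrC.
Qed.

Lemma ps_mulA : associative ps_mul.
Proof.
move=> a b c; apply: psP => n.
pose t := ps_trunc n.+1.
have tM p q i : (i <= n)%N -> (t (ps_mul p q))`_i = (t p * t q)`_i.
  by move=> le_in; rewrite coef_ps_truncM ?ltnS // coef_poly ltnS le_in.
have E p q r : (t (ps_mul p q) * t r)`_n = (t p * t q * t r)`_n.
  by rewrite !coefM; apply: eq_bigr => i _; rewrite tM // -ltnS.
rewrite -!(@coef_ps_truncM n.+1) // -/t E mulrC E.
by rewrite mulrC mulrA.
Qed.

Lemma ps_mul1 : left_id ps1 ps_mul.
Proof.
move=> a; apply: psP => n /=.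
rewrite big_ord_recl /= mul1r subn0 big1 ?addr0 // => i _.
by rewrite mul0r.
Qed.

Lemma ps_mulDl : left_distributive ps_mul +%R.
Proof.
move=> a b c; apply: psP => n /=.
by rewrite -big_split /=; apply: eq_bigr => i _; rewrite mulrDl.
Qed.

Lemma ps1_neq0 : ps1 != 0.
Proof.
by apply/eqP => /(congr1 (fun a => pscoef a 0%N)) /eqP; rewrite oner_eq0.
Qed.

HB.instance Definition _ := GRing.Zmodule_isComNzRing.Build (power_series R)
  ps_mulA ps_mulC ps_mul1 ps_mulDl ps1_neq0.

Definition ps_unit : {pred power_series R} :=
  fun a => `[< exists b, b * a = 1 >].

Definition ps_inv a : power_series R :=
  if pselect (exists b, b * a = 1) is left h then sval (cid h) else a.

Lemma ps_mulVx : {in ps_unit, left_inverse 1 ps_inv *%R}.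
Proof.
move=> a /asboolP h; rewrite /ps_inv; case: pselect => // h'.
exact: (svalP (cid h')).
Qed.

Lemma ps_unitPl a b : b * a = 1 -> ps_unit a.
Proof. by move=> h; apply/asboolP; exists b. Qed.

Lemma ps_inv_out : {in [predC ps_unit], ps_inv =1 id}.
Proof.
move=> a h; rewrite /ps_inv; case: pselect => // h'.
by case/negP: h; apply/asboolP.
Qed.

HB.instance Definition _ := GRing.ComNzRing_hasMulInverse.Build (power_series R)
  ps_mulVx ps_unitPl ps_inv_out.

End PowerSeriesRing.

Lemma ps_idomain (R : idomainType) : GRing.integral_domain_axiom (power_series R).
Proof.
move=> a b ab0; apply: contraT; rewrite negb_or => /andP[a0 b0].
have low (c : power_series R) : c != 0 ->
    exists m, pscoef c m != 0 /\ forall i, (i < m)%N -> pscoef c i = 0.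
  move=> c0; have h : exists m, pscoef c m != 0.
    apply: contrapT => h; case/eqP: c0; apply: psP => n /=.
    by apply: contrapT => /eqP cn; apply: h; exists n.
  case: (ex_minnP h) => m cm mmin; exists m; split=> // i im.
  by apply/eqP; apply: contraTT im => /mmin; rewrite -leqNgt.
have [m [am ma]] := low a a0; have [n [bn nb]] := low b b0.
have : pscoef (a * b) (m + n)%N = 0 by rewrite ab0.
have mlt : (m < (m + n).+1)%N by rewrite ltnS leq_addr.
rewrite /= (bigD1 (Ordinal mlt)) //= addKn big1 ?addr0.
  by move/eqP; rewrite mulf_eq0 (negPf am) (negPf bn).
move=> i im; have [ilt|ige] := ltnP i m; first by rewrite ma // mul0r.
rewrite nb ?mulr0 // ltn_subLR; last by rewrite -ltnS.
by rewrite ltn_add2r ltn_neqAle ige andbT eq_sym.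
Qed.

HB.instance Definition _ (R : idomainType) :=
  GRing.ComUnitRing_isIntegral.Build (power_series R) (@ps_idomain R).

(* F((t)) is the fraction field of F[[t]]. *)
Definition laurent_series (F : fieldType) : Type := {fraction (power_series F)}.

HB.instance Definition _ (F : fieldType) := GRing.Field.on (laurent_series F).

(* Main.v *)
(** The key fact is that every [K] satisfying [Th_ex F] satisfies [Th_ex F((t))]
    whenever [K] carries a nontrivial henselian valuation [v].  After replacing
    [K] by an ultrapower one may assume that [F] embeds in [K].  In a further
    ultrapower [K'] choose [c] infinitesimal with respect to [v(K)] and let [W]
    be the coarsening of the valuation whose maximal ideal is the intersection
    of the ideals [c^m O]; sending [t] to [c] embeds [F((t))] in the residue
    field of [W], since countable sums converge there.  Finally, the existential
    theory of the residue field of an equicharacteristic henselian valued field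
    is contained in that of the field: finitely generated subfields of the
    residue field lift after applying a power of Frobenius, which does not
    affect polynomial relations over the prime field.  Apart from this, one
    needs that [F((t))] is henselian. *)

Require Import Defs.
From HB Require Import structures.
From mathcomp Require Import all_boot all_order all_algebra all_field.
From mathcomp Require Import fraction ring_quotient generic_quotient.
From mathcomp Require Import boolp classical_sets filter.
From mathcomp Require Import ring zify.

Set Implicit Arguments.
Unset Strict Implicit.
Unset Printing Implicit Defensive.

Import GRing.Theory.

Local Open Scope ring_scope.

(** * Transfer of existential sentences *)

(** The statements meet in one identity, valid for every [F]: the existential sentences entailed for
    residue theory [Th_ex F] are exactly those of F((t)). F((t)) is itself a model, and the key fact
    puts its existential theory inside that of every other model. The obstacle is that embedding [F]
    in an ultrapower of [K] gives no control over the values of its image. The coefficients of a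
    power series may have unbounded denominators, so no fixed element of [K] makes the terms tend to
    zero. An infinitesimal beating every countable family of coefficients removes this, at the price
    of a ring homomorphism only modulo the maximal ideal of [W]. The coarsening also settles the
    characteristic. The valuation on the field in (v) may be of mixed characteristic, but [W] never
    is, since both the ultrapower and the residue field of [W] contain [F]. In (vii) equal
    characteristic is read off from the sentences p = 0. Henselianity is defined by unique
    extension, so for F((t)) the integral closure of F[[t]] in a finite extension has to be shown to
    be a valuation ring; this is where Weierstrass factorization enters. *)

Lemma cons_tuple_map (A B : Type) n (g : A -> B) x (e : n.-tuple A) :
  map_tuple g [tuple of x :: e] = [tuple of g x :: map_tuple g e].
Proof. exact: val_inj. Qed.

Lemma tuple0_eq (A : Type) (e : 0.-tuple A) : e = [tuple of [::]].
Proof. by apply: val_inj; rewrite /= (size0nil (size_tuple e)). Qed.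

Lemma existential_qf n (f : ring_formula n) : quantifier_free f -> existential f.
Proof. by case: f. Qed.

Section LocalTransfer.

Variables k K : fieldType.

(** Nonvanishing must be preserved along with vanishing, because negations are allowed. No
    homomorphism is asked for: the Frobenius-twisted lifts used later satisfy this without being
    restrictions of one. *)
Definition respects (s : seq k) (beta : k -> K) := forall n (e : n.-tuple k) t,
  {subset e <= s} -> (eval_term (map_tuple beta e) t == 0) = (eval_term e t == 0).

Lemma respects_qf s beta n (f : ring_formula n) (e : n.-tuple k) :
  respects s beta -> quantifier_free f -> {subset e <= s} ->
  holds (map_tuple beta e) f <-> holds e f.
Proof.
move=> sb + es; elim: f e es => //=.
- move=> {}n t1 t2 e es _.
  have /= E := sb n e (TAdd t1 (TOpp t2)) es.
  by rewrite !subr_eq0 in E; split=> /eqP h; apply/eqP; rewrite ?E // -E.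
- by move=> {}n f IH e es /(IH _ es) hf; rewrite hf.
- by move=> {}n f IHf g IHg e es /andP[/(IHf _ es) hf /(IHg _ es) hg]; split; rewrite hf hg.
- by move=> {}n f IHf g IHg e es /andP[/(IHf _ es) hf /(IHg _ es) hg]; split; rewrite hf hg.
Qed.

(** [s] collects [e] and the witnesses of the quantifiers, so it depends on [k] alone and is fixed
    before [beta] is chosen. *)
Lemma respects_existential n (f : ring_formula n) (e : n.-tuple k) :
  existential f -> holds e f ->
  exists2 s : seq k, {subset e <= s} &
    forall beta, respects s beta -> holds (map_tuple beta e) f.
Proof.
have qf m (g : ring_formula m) (e' : m.-tuple k) : quantifier_free g ->
    holds e' g -> exists2 s : seq k, {subset e' <= s} & forall beta,
    respects s beta -> holds (map_tuple beta e') g.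
  by move=> qg hg; exists e' => // beta sb; apply/(respects_qf sb qg).
elim: f e => [m t1 t2|m g _|m g1 _ g2 _|m g1 _ g2 _|m g IH|m g IH] e ef he;
  try exact: (qf _ _ _ ef he).
case: he => x hx; have [s es hs] := IH _ ef hx.
exists s => [y ye|beta sb]; first by apply: es; rewrite inE ye orbT.
by exists (beta x); rewrite -cons_tuple_map; apply: hs.
Qed.

Lemma local_transfer :
  (forall s : seq k, exists beta, respects s beta) -> (Th_ex k `<=` Th_ex K)%classic.
Proof.
move=> loc phi [phik ephi]; split=> //.
have [s _ hs] := respects_existential ephi phik.
have [beta /hs] := loc s.
by rewrite [map_tuple _ _]tuple0_eq.
Qed.

End LocalTransfer.

Lemma eval_term_map (R S : nzRingType) (g : {rmorphism R -> S}) n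
    (e : n.-tuple R) (t : ring_term n) :
  eval_term (map_tuple g e) t = g (eval_term e t).
Proof.
elim: t => /= [i|||t ->|t -> u ->|t -> u ->].
- by rewrite tnth_map.
- by rewrite rmorph0.
- by rewrite rmorph1.
- by rewrite rmorphN.
- by rewrite rmorphD.
- by rewrite rmorphM.
Qed.

Lemma Th_ex_rmorphism (k K : fieldType) (g : {rmorphism k -> K}) :
  (Th_ex k `<=` Th_ex K)%classic.
Proof.
apply: local_transfer => s; exists g => n e t _.
by rewrite eval_term_map fmorph_eq0.
Qed.

Lemma isomorphic_elem_equiv (k K : fieldType) : field_isomorphic k K -> elem_equiv k K.
Proof.
case=> g [h gK hK].
suff H n (f : ring_formula n) (e : n.-tuple k) : holds e f <-> holds (map_tuple g e) f.
  by move=> phi; rewrite /satisfies (H _ _ [tuple of [::]]) [map_tuple _ _]tuple0_eq.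
elim: f e => /= [{}n t1 t2|{}n f IH|{}n f IHf f' IHf'|{}n f IHf f' IHf'|{}n f IH|{}n f IH] e.
- by rewrite !eval_term_map; split=> [->//|/fmorph_inj].
- by rewrite IH.
- by rewrite IHf IHf'.
- by rewrite IHf IHf'.
- split=> [[x /IH]|[x]]; first by rewrite cons_tuple_map; exists (g x).
  by move=> hx; exists (h x); apply/IH; rewrite cons_tuple_map hK.
- split=> H x; last by apply/IH; rewrite cons_tuple_map.
  by rewrite -[x]hK -cons_tuple_map; apply/IH.
Qed.

Lemma elem_equiv_Th_ex (k K : fieldType) : elem_equiv k K -> Th_ex k = Th_ex K.
Proof. by move=> kK; apply/seteqP; split=> phi [+ ?] => /kK. Qed.

Fixpoint ex_closure n : ring_formula n -> ring_sentence :=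
  if n is m.+1 then fun f => ex_closure (FExists f) else fun f => f.

Lemma existential_closure n (f : ring_formula n) :
  existential f -> existential (ex_closure f).
Proof. by elim: n f => //= n IH f ef; apply: IH. Qed.

Lemma satisfies_closure (R : nzRingType) n (f : ring_formula n) :
  satisfies R (ex_closure f) <-> exists e : n.-tuple R, holds e f.
Proof.
elim: n f => [|n IH] f /=.
  by split=> [?|[e]]; [exists [tuple of [::]]|rewrite [e]tuple0_eq].
rewrite IH; split=> [[e [x h]]|[e h]]; first by exists [tuple of x :: e].
exists (behead_tuple e), (thead e).
by rewrite [X in holds X _](_ : _ = e) //; apply: val_inj; case: e {h} => -[].
Qed.

Definition conj_formula n (fs : seq (ring_formula n)) : ring_formula n :=
  foldr (@FAnd n) (FEq (TZero n) (TZero n)) fs.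

Lemma conj_formula_qf n (fs : seq (ring_formula n)) :
  all (@quantifier_free n) fs -> quantifier_free (conj_formula fs).
Proof. by elim: fs => //= f fs IH /andP[-> /IH]. Qed.

Lemma holds_conj (R : nzRingType) n (e : n.-tuple R) (I : eqType) (r : seq I)
    (f : I -> ring_formula n) :
  holds e (conj_formula [seq f i | i <- r]) <-> forall i, i \in r -> holds e (f i).
Proof.
elim: r => //= i r [IH1 IH2]; split=> [[fi /IH1 h] j|h].
  by rewrite inE => /predU1P[->//|/h].
split; first by apply: h; rewrite mem_head.
by apply: IH2 => j jr; apply: h; rewrite inE jr orbT.
Qed.

(** * Valuation rings *)

Section ValuationRing.

Variables (K : fieldType) (v : valuation_ring K).

Definition vmax : {pred K} := [pred x | (x == 0) || (x^-1 \notin v)].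

Lemma vmaxE x : (x \in vmax) = (x == 0) || (x^-1 \notin v).
Proof. by []. Qed.

Lemma vmax_sub x : x \in vmax -> x \in v.
Proof.
rewrite vmaxE => /predU1P[->|xV]; first exact: rpred0.
by have := vr_total v x; rewrite (negPf xV) orbF.
Qed.

Lemma vmax_max_ideal (x : vr_elt v) : (vr_val x \in vmax) = (x \in @max_ideal _ v).
Proof. by []. Qed.

Lemma vmaxMl a x : a \in v -> x \in vmax -> a * x \in vmax.
Proof.
move=> av xm; rewrite -[a * x]/(vr_val (VrElt av * VrElt (vmax_sub xm))).
by rewrite vmax_max_ideal max_idealM.
Qed.

Lemma vmaxMr a x : a \in v -> x \in vmax -> x * a \in vmax.
Proof. by rewrite mulrC; apply: vmaxMl. Qed.

Fact vmax_zmod_closed : zmod_closed vmax.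
Proof.
split=> [|x y xm ym]; first by rewrite vmaxE eqxx.
have nym : - y \in vmax by rewrite -mulN1r vmaxMl // rpredN rpred1.
rewrite -[x - y]/(vr_val (VrElt (vmax_sub xm) + VrElt (vmax_sub nym))).
by rewrite vmax_max_ideal max_idealD.
Qed.
HB.instance Definition _ := GRing.isZmodClosed.Build K vmax vmax_zmod_closed.

Lemma vmax1 : 1 \notin vmax.
Proof. by rewrite vmaxE oner_eq0 invr1 negbK rpred1. Qed.

Lemma vmaxN1 : -1 \notin vmax.
Proof. by rewrite rpredN vmax1. Qed.

Lemma vmax0 : 0 \in vmax. Proof. exact: rpred0. Qed.

Lemma notin_vmax_neq0 x : x \notin vmax -> x != 0.
Proof. by apply: contraNneq => ->; apply: rpred0. Qed.

Lemma notin_vmax_inv x : x \notin vmax -> x^-1 \in v.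
Proof. by rewrite vmaxE negb_or negbK => /andP[]. Qed.

Lemma notin_vr_inv x : x \notin v -> x^-1 \in vmax.
Proof. by move=> xv; rewrite vmaxE invrK xv orbT. Qed.

Lemma notin_vmaxV x : x \in v -> x != 0 -> x^-1 \notin vmax.
Proof. by move=> xv x0; rewrite vmaxE invr_eq0 (negPf x0) invrK xv. Qed.

Lemma vmax_prime x y : x \in v -> x * y \in vmax -> (x \in vmax) || (y \in vmax).
Proof.
move=> xv xym; case: (boolP (x \in vmax)) => //= xm.
by rewrite -[y](mulKf (notin_vmax_neq0 xm)) vmaxMl ?notin_vmax_inv.
Qed.

Lemma vmaxX x n : x \in v -> x ^+ n \in vmax -> x \in vmax.
Proof.
move=> xv; elim: n => [|n IH]; first by rewrite expr0 (negPf vmax1).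
by rewrite exprS => /(vmax_prime xv)/orP[|/IH].
Qed.

Lemma vmax_exp x n : x \in vmax -> x ^+ n.+1 \in vmax.
Proof. by move=> xm; rewrite exprSr vmaxMl // rpredX // vmax_sub. Qed.

Lemma vmax_trans x y z : x - y \in vmax -> y - z \in vmax -> x - z \in vmax.
Proof. by move=> xy yz; rewrite -(subrKA y); apply: rpredD. Qed.

Lemma vmax_congr x y : x - y \in vmax -> (x \in vmax) = (y \in vmax).
Proof. by move=> xy; rewrite -[x](subrK y); apply: rpredDl. Qed.

Lemma vr_congr x y : x - y \in vmax -> (x \in v) = (y \in v).
Proof. by move=> /vmax_sub xy; rewrite -[x](subrK y); apply: rpredDl. Qed.

Lemma vmax_subX x y n : x \in v -> y \in v -> x - y \in vmax ->
  x ^+ n - y ^+ n \in vmax.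
Proof.
move=> xv yv xy; rewrite subrXX; apply: vmaxMr => //; apply: rpred_sum => i _.
by rewrite rpredM // rpredX.
Qed.

Lemma vmax_subM x y x' y' : x \in v -> y' \in v -> x - y \in vmax ->
  x' - y' \in vmax -> x * x' - y * y' \in vmax.
Proof.
move=> xv yv xy xy'.
have -> : x * x' - y * y' = x * (x' - y') + (x - y) * y' by ring.
by apply: rpredD; [apply: vmaxMl|apply: vmaxMr].
Qed.

Lemma vmax_horner (f : {poly K}) x y : f \is a polyOver v -> x \in v -> y \in v ->
  x - y \in vmax -> f.[x] - f.[y] \in vmax.
Proof.
move=> /polyOverP fv xv yv xy; rewrite !horner_coef -sumrB rpred_sum // => i _.
by rewrite -mulrBr; apply: vmaxMl => //; apply: vmax_subX.
Qed.

(* Every simple zero of a polynomial over the residue field lifts; the equation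
   [X^(n+2) + X^(n+1) + c_n X^n + ... + c_0] with infinitesimal [c_i] captures
   this in general and is the form preserved by ultraproducts and coarsenings. *)
Definition hensel_axiom := forall n (c : nat -> K), (forall i, c i \in vmax) ->
  exists2 b, b + 1 \in vmax &
    b ^+ n.+2 + b ^+ n.+1 + \sum_(i < n.+1) c i * b ^+ i = 0.

End ValuationRing.

Lemma vmax_subset (K : fieldType) (v W : valuation_ring K) :
  {subset v <= W} -> {subset vmax W <= vmax v}.
Proof.
move=> vW x; rewrite !vmaxE => /orP[->//|xW].
by rewrite (contra (vW _) xW) orbT.
Qed.

(** Infinitesimals of the coarsening [W] are infinitesimals of [v], so the axiom for [v] serves
    every coarsening. Substituting y = eps / (u b) in the Taylor expansion of f(a + y) and
    multiplying by b^(n+2) / eps gives an equation of the required shape in b. *)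
Lemma hensel_lift (K : fieldType) (v W : valuation_ring K) (f : {poly K}) a :
  hensel_axiom v -> {subset v <= W} ->
  f \is a polyOver W -> a \in W -> f.[a] \in vmax W -> f^`().[a] \notin vmax W ->
  exists2 b, root f b & b - a \in vmax W.
Proof.
move=> hv vW fW aW; set eps := f.[a]; set u := f^`().[a] => epsm um.
have [eps0|eps0] := eqVneq eps 0.
  by exists a; [apply/rootP | rewrite subrr vmax0].
have u0 := notin_vmax_neq0 um; have uV := notin_vmax_inv um.
set g := f \Po ('X + a%:P).
have gW : g \is a polyOver W.
  by rewrite polyOver_comp // rpredD ?polyOverX ?polyOverC.
have g0 : g`_0 = eps.
  by rewrite -horner_coef0 horner_comp !hornerE.
have g1 : g`_1 = u.
  have -> : g`_1 = g^`()`_0 by rewrite coef_deriv mulr1n.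
  rewrite -horner_coef0 deriv_comp !derivE addr0 mulr1 horner_comp !hornerE //.
set n := size g.
have sg : (size g <= n.+3)%N by rewrite -/n 3?leqW.
(* After division by eps, [d i] is the coefficient of b^-i; for i >= 2 it keeps a factor eps and is
   infinitesimal. *)
pose d i := g`_i * eps ^+ i.-1 / u ^+ i.
have dm i : d i.+2 \in vmax W.
  rewrite /d /= vmaxMr -?exprVn ?rpredX // vmaxMl ?(polyOverP gW) //.
  exact: vmax_exp.
have [|b b1 hb] := hv n (fun i => d (n - i).+2).
  by move=> i; apply/(vmax_subset vW)/dm.
have bv : b \in v by rewrite -(rpredDr _ (rpred1 v)) vmax_sub.
have bm : b \notin vmax v.
  by rewrite (@vmax_congr _ _ b (-1)) ?opprK // vmaxN1.
have b0 := notin_vmax_neq0 bm.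
pose y := eps / (u * b).
have ym : y \in vmax W.
  by rewrite vmaxMr // invfM rpredM // vW // notin_vmax_inv.
exists (a + y); last by rewrite addrAC subrr add0r.
apply/rootP; have -> : f.[a + y] = g.[y] by rewrite horner_comp !hornerE addrC.
rewrite (horner_coef_wide _ sg) 2!big_ord_recl /= g0 g1 mulr1 expr1.
transitivity (eps / b ^+ n.+2 * (b ^+ n.+2 + b ^+ n.+1 +
  \sum_(i < n.+1) d (n - i).+2 * b ^+ i)); last by rewrite hb mulr0.
rewrite mulrDr mulrDr -[RHS]addrA.
congr (_ + (_ + _)).
- by rewrite divfK ?expf_neq0.
- rewrite /y [b ^+ n.+2]exprS; move: (expf_neq0 n.+1 b0); move: (b ^+ _) => B B0;
  by field; rewrite ?b0 ?u0 ?B0.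
rewrite mulr_sumr [RHS](reindex_inj rev_ord_inj) /=; apply: eq_bigr => i _.
rewrite /bump /= !add1n subSS (subKn (ltnSE (ltn_ord i))).
have -> : b ^+ n.+2 = b ^+ i.+2 * b ^+ (n - i)%N.
  by rewrite -exprD addSn addSn subnKC // -ltnS.
rewrite /d /y /= expr_div_n exprMn [eps ^+ _.+2]exprS.
move: (expf_neq0 i.+2 u0) (expf_neq0 i.+2 b0) (expf_neq0 (n - i)%N b0).
move: (u ^+ _) (b ^+ _) (b ^+ _) (eps ^+ _) => U B B' e U0 B0 B'0.
by field; rewrite ?U0 ?B0 ?B'0.
Qed.

(** * Lifting subfields of the residue field *)

Section Subfield.

Variables (K : fieldType) (W : valuation_ring K).

Record subfield_in := SubfieldIn {
  sf_mem :> {pred K};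
  sf_closed : divring_closed sf_mem;
  sf_sub : {subset sf_mem <= W} }.

HB.instance Definition _ (L : subfield_in) :=
  GRing.isDivringClosed.Build K (sf_mem L) (sf_closed L).

Lemma sf_vmax (L : subfield_in) x : x \in L -> x \in vmax W -> x = 0.
Proof.
move=> xL; apply: contraTeq => x0.
by rewrite vmaxE (negPf x0) negbK (@sf_sub L) // rpredV.
Qed.

(** Nonzero elements of [A] are units of [W], so the fractions of [A] remain in [W]. *)
Lemma subfield_of_subring (A : {pred K}) : subring_closed A ->
  {subset A <= W} -> (forall x, x \in A -> x \in vmax W -> x = 0) ->
  exists L : subfield_in, {subset A <= L}.
Proof.
move=> [A1 AB AM] AW Am.
have A0 : 0 \in A by rewrite -(subrr 1) AB.
have AN x : x \in A -> - x \in A by move=> xA; rewrite -sub0r AB.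
pose L := [pred x | `[< exists a b, [/\ a \in A, b \in A, b != 0 & x = a / b] >]].
have AL x : x \in A -> x \in L.
  by move=> xA; apply/asboolP; exists x, 1; rewrite oner_neq0 divr1.
have Lc : divring_closed L.
  split; first exact: AL.
    move=> _ _ /asboolP[a [b [aA bA b0 ->]]] /asboolP[c [d [cA dA d0 ->]]].
    apply/asboolP; exists (a * d - c * b), (b * d); split.
    - by rewrite AB ?AM.
    - exact: AM.
    - by rewrite mulf_neq0.
    - by field; rewrite b0 d0.
  move=> _ _ /asboolP[a [b [aA bA b0 ->]]] /asboolP[c [d [cA dA d0 ->]]].
  have [->|c0] := eqVneq c 0.
    by rewrite mul0r invr0 mulr0; apply: AL.
  apply/asboolP; exists (a * d), (b * c); split; rewrite ?AM ?mulf_neq0 //.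
  by field; rewrite b0 c0.
have LW : {subset L <= W}.
  move=> _ /asboolP[a [b [aA bA b0 ->]]]; apply: rpredM; first exact: AW.
  by apply: notin_vmax_inv; apply: contra b0 => /(Am _ bA) ->.
by exists (SubfieldIn Lc LW).
Qed.

Hypothesis Wchar : forall n : nat, n%:R \in vmax W -> n%:R = 0 :> K.

Lemma prime_subfield : subfield_in.
Proof.
pose A := [pred x : K | `[< exists z : int, x = z%:~R >]].
suff /cid[L _] : exists L : subfield_in, {subset A <= L} by exact: L.
apply: subfield_of_subring.
- split; first by apply/asboolP; exists 1.
    move=> _ _ /asboolP[a ->] /asboolP[b ->]; apply/asboolP; exists (a - b).
    by rewrite intrD rmorphN.
  by move=> _ _ /asboolP[a ->] /asboolP[b ->]; apply/asboolP; exists (a * b); rewrite intrM.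
- by move=> _ /asboolP[a ->]; apply: rpred_int.
move=> _ /asboolP[[n|n] ->].
  exact: Wchar.
by rewrite NegzE rmorphN rpredN => /(@Wchar n.+1) /= E; rewrite -pmulrn E oppr0.
Qed.

Section Extension.

Variables (L : subfield_in) (q : nat) (alpha : K).
Hypothesis q_char : q = 1%N /\ [pchar K] =i pred0 \/ q \in [pchar K].
Hypothesis W_lift : forall (f : {poly K}) a, f \is a polyOver W -> a \in W ->
  f.[a] \in vmax W -> f^`().[a] \notin vmax W ->
  exists2 b, root f b & b - a \in vmax W.
Hypothesis alphaW : alpha \in W.

Lemma sf_polyOver (f : {poly K}) : f \is a polyOver L -> f \is a polyOver W.
Proof. by move/polyOverP => fL; apply/polyOverP => i; apply: (sf_sub (fL i)). Qed.

Lemma subfield_adjoin b : b \in W ->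
  (forall h, h \is a polyOver L -> h.[b] \in vmax W -> h.[b] = 0) ->
  exists L' : subfield_in, {subset L <= L'} /\ b \in L'.
Proof.
move=> bW hb.
pose A := [pred x : K | `[< exists2 h, h \is a polyOver L & x = h.[b] >]].
have [||x|L' AL'] := @subfield_of_subring A.
- split; first by apply/asboolP; exists 1; rewrite ?rpred1 // hornerC.
    move=> _ _ /asboolP[f fL ->] /asboolP[g gL ->]; apply/asboolP; exists (f - g).
      by rewrite rpredB.
    by rewrite !hornerE.
  move=> _ _ /asboolP[f fL ->] /asboolP[g gL ->]; apply/asboolP; exists (f * g).
    by rewrite rpredM.
  by rewrite !hornerE.
- by move=> _ /asboolP[h hL ->]; apply: rpred_horner => //; apply: sf_polyOver.
- by move=> /asboolP[h hL ->]; apply: hb.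
exists L'; split=> [x xL|]; apply: AL'; apply/asboolP.
  by exists x%:P; rewrite ?polyOverC ?hornerC.
by exists 'X; rewrite ?polyOverX ?hornerX.
Qed.

(** Only exponents divisible by the characteristic survive. The coefficients of [g] are coefficients
    of [f], so they stay in [L] and no q-th roots are taken. *)
Lemma deriv0_comp (f : {poly K}) : f \is monic -> (1 < size f)%N -> f^`() = 0 ->
  q \in [pchar K] /\ exists g : {poly K}, [/\ f = g \Po 'X^q, g \is monic,
    (size g < size f)%N & forall i, g`_i = 0 \/ g`_i = f`_(i * q)].
Proof.
move=> fm sf f'0.
have fq i : f`_i != 0 -> i%:R = 0 :> K.
  case: i => // i fi; have : f^`()`_i = 0 by rewrite f'0 coef0.
  by rewrite coef_deriv -[_ *+ _]mulr_natr => /eqP; rewrite mulf_eq0 (negPf fi) => /eqP.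
set d := (size f).-1; have d1 : (0 < d)%N by rewrite /d; case: (size f) sf => [|[]].
have fd : f`_d = 1 by apply/eqP; rewrite -[_ == _]/(f \is monic).
have dq : d%:R = 0 :> K by apply: fq; rewrite fd oner_neq0.
have qK : q \in [pchar K].
  case: q_char => // -[_ K0]; have [p] : exists p, p \in [pchar K].
    by apply: natf0_pchar d1 _; rewrite dq.
  by rewrite K0.
split=> //; have q0 : (0 < q)%N by rewrite prime_gt0 // (pcharf_prime qK).
have fdvd i : f`_i != 0 -> (q %| i)%N by move/fq/eqP; rewrite (dvdn_pcharf qK).
have qd : (q %| d)%N by apply: fdvd; rewrite fd oner_neq0.
exists (\poly_(j < (d %/ q).+1) f`_(j * q)).
have gd : f`_(d %/ q * q) != 0 by rewrite divnK // fd oner_neq0.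
split.
- apply/polyP => i; rewrite coef_comp_poly_Xn // coef_poly ltnS.
  case: ifP => [qi|/negbT qi]; last by apply/eqP; apply: contraNT qi => /fdvd.
  rewrite divnK //; case: leqP => // di; apply/nth_default.
  by move: di; rewrite ltn_divLR // divnK // /d; case: (size f).
- by rewrite monicE lead_coef_poly //= divnK // fd.
- rewrite size_poly_eq //= -[X in (_ < X)%N](@prednK (size f)) ?ltnS ?(ltn_trans _ sf) //.
  by rewrite -/d ltn_Pdiv // prime_gt1 // (pcharf_prime qK).
- by move=> i; rewrite coef_poly; case: ifP; [right|left].
Qed.

(** If the residue of [alpha] is transcendental over [L], adjoining [alpha] itself works. Otherwise
    some Frobenius power of the residue is separable over [L] and lifts by Hensel's lemma. *)
Lemma subfield_lift_elt : exists (L' : subfield_in) s b,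
  [/\ {subset L <= L'}, b \in L' & b - alpha ^+ (q ^ s) \in vmax W].
Proof.
(* The degree is minimized over the exponent [s] and the polynomial together, so that replacing [f]
   by [g] with f = g(X^q) and [s] by [s.+1] counts as a descent. *)
pose P n := `[< exists s (f : {poly K}), [/\ f \is monic, f \is a polyOver L,
  f.[alpha ^+ (q ^ s)] \in vmax W & size f = n] >].
have normalize s (h : {poly K}) : h != 0 -> h \is a polyOver L ->
    h.[alpha ^+ (q ^ s)] \in vmax W -> P (size h).
  move=> h0 hL hm; apply/asboolP; exists s, ((lead_coef h)^-1 *: h).
  have lL : (lead_coef h)^-1 \in L by rewrite rpredV lead_coefE (polyOverP hL).
  split; last by rewrite size_scale // invr_eq0 lead_coef_eq0.
  - by rewrite monicE lead_coefZ mulVf // lead_coef_eq0.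
  - by rewrite polyOverZ.
  - by rewrite hornerZ; apply: vmaxMl => //; apply: sf_sub lL.
case: (pselect (exists n, P n)) => [exP|nP]; last first.
  have [|L' [LL' aL']] := @subfield_adjoin alpha alphaW.
    move=> h hL hm; have [->|h0] := eqVneq h 0; first by rewrite horner0.
    by case: nP; exists (size h); apply: (normalize 0%N); rewrite // expn0 expr1.
  by exists L', 0%N, alpha; rewrite expn0 expr1 subrr vmax0.
case: (ex_minnP exP) => n /asboolP[s [f [fm fL fa sf]]] nmin.
set beta := alpha ^+ (q ^ s) in fa.
have betaW : beta \in W by rewrite rpredX.
have f1 : (1 < size f)%N.
  rewrite ltn_neqAle eq_sym size_poly_gt0 monic_neq0 // andbT.
  apply/negP => /size_poly1P[c c0 fc]; move: fa fm.
  by rewrite fc hornerC monicE lead_coefC => + /eqP c1; rewrite c1 (negPf (vmax1 W)).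
(* Minimality makes the root simple: a nonzero derivative vanishing residually would have smaller
   degree, and a zero derivative gives g(X^q). *)
have f'b : f^`().[beta] \notin vmax W.
  apply/negP => f'm; have [f'0|f'0] := eqVneq f^`() 0.
    have [qK [g [fg gm sg gf]]] := deriv0_comp fm f1 f'0.
    have : P (size g).
      apply/asboolP; exists s.+1, g; split=> //.
        apply/polyOverP => i; case: (gf i) => ->; first exact: rpred0.
        exact: (polyOverP fL).
      by move: fa; rewrite fg horner_comp hornerXn -exprM expnSr.
    by move/nmin; rewrite -sf leqNgt sg.
  have : P (size f^`()).
    by apply: (normalize s) => //; apply: polyOver_deriv.
  by move/nmin; rewrite -sf leqNgt lt_size_deriv // monic_neq0.
have [b /rootP fb bbeta] := W_lift (sf_polyOver fL) betaW fa f'b.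
have bW : b \in W by rewrite (vr_congr bbeta).
have [|L' [LL' bL']] := @subfield_adjoin b bW; last by exists L', s, b.
move=> h hL; rewrite (vmax_congr (vmax_horner (sf_polyOver hL) bW betaW bbeta)).
(* Long division by [f]. Since f(b) = 0 exactly, reducing [h] changes neither h(b) nor its
   membership in the maximal ideal, and minimality keeps [f] no longer than a nonzero [h]. *)
move: hL; have [N] := ubnP (size h); elim: N h => // N IH h; rewrite ltnS => hN hL hm.
have [->|h0] := eqVneq h 0; first by rewrite horner0.
have fh : (size f <= size h)%N by rewrite sf nmin // (@normalize s).
pose c := lead_coef h; pose r := h - (c *: 'X^(size h - size f)) * f.
have cL : c \in L by rewrite /c lead_coefE (polyOverP hL).
have kL : c *: 'X^(size h - size f) \is a polyOver L.
  by rewrite polyOverZ // rpredX // polyOverX.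
have rE x : r.[x] = h.[x] - (c *: 'X^(size h - size f)).[x] * f.[x].
  by rewrite /r !hornerE.
have : r.[b] = 0; last by rewrite rE fb mulr0 subr0.
apply: IH.
- apply: leq_trans hN; rewrite -[X in (_ < X)%N](@prednK (size h)) ?size_poly_gt0 // ltnS.
  apply/leq_sizeP => j hj; rewrite coefB -scalerAl coefZ coefXnM.
  have hfj : (size h - size f <= j)%N.
    by apply: leq_trans hj; rewrite -subn1 leq_sub2l // (ltn_trans _ f1).
  rewrite ltnNge hfj /=; move: hj; rewrite leq_eqVlt => /predU1P[<-|hj].
    have -> : ((size h).-1 - (size h - size f))%N = (size f).-1.
      by rewrite -subn1 subnAC subKn // subn1.
    by rewrite -!lead_coefE (monicP fm) mulr1 subrr.
  rewrite !nth_default ?mulr0 ?subrr //.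
    by rewrite leq_subRL // subnK //; move: hj; case: (size h).
  by move: hj; case: (size h).
- by rewrite rpredB // rpredM.
rewrite rE rpredB //; apply: vmaxMl => //.
by apply: rpred_horner => //; apply: sf_polyOver.
Qed.

End Extension.

Section SeqLift.

Variable q : nat.
Hypothesis q_char : q = 1%N /\ [pchar K] =i pred0 \/ q \in [pchar K].
Hypothesis W_lift : forall (f : {poly K}) a, f \is a polyOver W -> a \in W ->
  f.[a] \in vmax W -> f^`().[a] \notin vmax W ->
  exists2 b, root f b & b - a \in vmax W.

(** Each new element may need a further Frobenius power; the earlier lifts are raised to that power
    to keep a common exponent. *)
Lemma subfield_lift_seq (s : seq K) : {subset s <= W} ->
  exists (L : subfield_in) N, forall a, a \in s ->
    exists2 b, b \in L & b - a ^+ (q ^ N) \in vmax W.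
Proof.
elim: s => [|a s IH] sW; first by exists prime_subfield, 0%N.
have aW : a \in W by apply: sW; rewrite mem_head.
have [|L [N hN]] := IH; first by move=> x xs; apply: sW; rewrite inE xs orbT.
have [|L' [s' [b [LL' bL' hb]]]] := @subfield_lift_elt L q (a ^+ (q ^ N)) q_char W_lift.
  by rewrite rpredX.
exists L', (N + s')%N => x; rewrite inE => /predU1P[->|/[dup] xs /hN[c cL hc]].
  by exists b => //; rewrite expnD exprM.
have xW : x \in W by apply: sW; rewrite inE xs orbT.
exists (c ^+ (q ^ s')); first by rewrite rpredX // LL'.
rewrite expnD exprM; apply: vmax_subX => //; last by rewrite rpredX.
by apply: sf_sub cL.
Qed.

Lemma frobD N : {morph (fun x : K => x ^+ (q ^ N)) : x y / x + y}.
Proof.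
case: q_char => [[-> _]|qK] x y; first by rewrite exp1n !expr1.
apply: exprDn_pchar; rewrite pnatX (eq_pnat _ (pcharf_eq qK)) pnat_id ?orbT //.
exact: pcharf_prime qK.
Qed.

Lemma q_gt0 : (0 < q)%N.
Proof. by case: q_char => [[-> _]//|/pcharf_prime/prime_gt0]. Qed.

End SeqLift.

(* A homomorphism from [k] to the residue field of [W], given by representatives. *)
Record residual_map (k : nzRingType) (theta : k -> K) : Prop := ResidualMap {
  res_mem : forall x, theta x \in W;
  res_1 : theta 1 - 1 \in vmax W;
  res_D : forall x y, theta (x + y) - (theta x + theta y) \in vmax W;
  res_M : forall x y, theta (x * y) - theta x * theta y \in vmax W }.

Lemma res_0 (k : nzRingType) (theta : k -> K) : residual_map theta -> theta 0 \in vmax W.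
Proof.
by move/res_D/(_ 0 0); rewrite addr0 opprD addrA subrr sub0r rpredN.
Qed.

Lemma res_neq0 (k : fieldType) (theta : k -> K) x :
  residual_map theta -> x != 0 -> theta x \notin vmax W.
Proof.
move=> th x0; apply: contra (vmax1 W) => xm.
rewrite -(vmax_congr (res_1 th)) -(divff x0) (vmax_congr (res_M th _ _)).
by apply: vmaxMr => //; apply: res_mem.
Qed.

(* A finitely generated subfield of the residue field need not lift when it is
   imperfect, but its image under a power of Frobenius does, and Frobenius
   preserves polynomial relations over the prime field. *)
Lemma Th_ex_residual (k : fieldType) (theta : k -> K) :
  residual_map theta ->
  (forall (f : {poly K}) a, f \is a polyOver W -> a \in W ->
    f.[a] \in vmax W -> f^`().[a] \notin vmax W ->
    exists2 b, root f b & b - a \in vmax W) ->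
  (Th_ex k `<=` Th_ex K)%classic.
Proof.
move=> th W_lift; have thW := res_mem th.
have [q q_char] : exists q, q = 1%N /\ [pchar K] =i pred0 \/ q \in [pchar K].
  case: (pselect (exists q, q \in [pchar K])) => [[q qK]|nq]; first by exists q; right.
  exists 1%N; left; split=> // p; rewrite [RHS]/=; apply/negbTE/negP => pK.
  by case: nq; exists p.
apply: local_transfer => s.
have [|L [N hN]] := @subfield_lift_seq _ q_char W_lift [seq theta x | x <- s].
  by move=> _ /mapP[x _ ->].
set Q := (q ^ N)%N in hN; have Q0 : (0 < Q)%N by rewrite expn_gt0 (q_gt0 q_char).
have QD (x y : K) : (x + y) ^+ Q = x ^+ Q + y ^+ Q by apply: frobD.
have mQ (x : K) : x \in vmax W -> x ^+ Q \in vmax W by rewrite -(prednK Q0); apply: vmax_exp.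
have /choice[beta hb] (x : k) : exists b, x \in s -> b \in L /\ b - theta x ^+ Q \in vmax W.
  case: (boolP (x \in s)) => xs; last by exists 0.
  by have [|b bL hb] := hN (theta x); [apply: map_f | exists b].
exists beta => n e t es.
have ebL (u : ring_term n) : eval_term (map_tuple beta e) u \in L.
  elim: u => /= [i|||u uL|u uL w wL|u uL w wL]; rewrite ?rpred0 ?rpred1 ?rpredN ?rpredD ?rpredM //.
  by rewrite tnth_map; have [] := hb _ (es _ (mem_tnth i e)).
have ebW u : eval_term (map_tuple beta e) u \in W by apply: sf_sub (ebL u).
(* Values of terms at the lifts reduce to the Q-th powers of the residues of the true values. As the
   lifts lie in the field [L], which meets the maximal ideal only in 0, vanishing can be tested
   residually. *)
have key (u : ring_term n) :
    eval_term (map_tuple beta e) u - theta (eval_term e u) ^+ Q \in vmax W.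
  have red x y z : theta x - z \in vmax W -> z \in W -> y - z ^+ Q \in vmax W ->
      y - theta x ^+ Q \in vmax W.
    move=> xz zW yz; apply: vmax_trans yz _; rewrite -opprB rpredN.
    exact: vmax_subX.
  elim: u => /= [i|||u IH|u IHu w IHw|u IHu w IHw].
  - by rewrite tnth_map; have [] := hb _ (es _ (mem_tnth i e)).
  - by rewrite sub0r rpredN mQ // res_0.
  - by apply: red (res_1 th) _ _; rewrite ?rpred1 // expr1n subrr vmax0.
  - move: (eval_term _ u) IH => x; set y := eval_term _ u => xy.
    rewrite -opprD rpredN.
    have -> : x + theta (- y) ^+ Q = x - theta y ^+ Q + (theta y + theta (- y)) ^+ Q.
      by rewrite QD addrA subrK.
    rewrite rpredD // mQ // -(vmax_congr (res_D th y (- y))) subrr.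
    exact: res_0.
  - apply: red (res_D th _ _) _ _; first by rewrite rpredD.
    by rewrite QD opprD addrACA rpredD.
  - apply: red (res_M th _ _) _ _; first by rewrite rpredM.
    by rewrite exprMn; apply: vmax_subM => //; rewrite rpredX.
apply/eqP/eqP => [e0|e0].
  apply/eqP; apply: contraT => /(res_neq0 th) /negP[].
  by apply: (@vmaxX _ _ _ Q) => //; rewrite -rpredN -sub0r -e0 key.
apply: (sf_vmax (ebL t)); rewrite (vmax_congr (key t)) e0 mQ //.
exact: res_0.
Qed.

End Subfield.

(** * Henselian valuation rings satisfy Hensel's lemma *)

Lemma irreducible_factor (F : fieldType) (p : {poly F}) : (1 < size p)%N ->
  exists2 r, r %| p & irreducible_poly r.
Proof.
move=> p1; pose P n := `[< exists r, [/\ r %| p, (1 < size r)%N & size r = n] >].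
have exP : exists n, P n by exists (size p); apply/asboolP; exists p.
case: (ex_minnP exP) => n /asboolP[r [rp r1 rn]] nmin; exists r => //; split=> // q q1 qr.
have r0 : r != 0 by rewrite -size_poly_gt0 ltnW.
have q0 : q != 0 by apply: contraNneq r0 => q0; rewrite q0 dvd0p in qr.
rewrite -dvdp_size_eqp // eqn_leq dvdp_leq //= rn nmin //; apply/asboolP; exists q.
split=> //; first exact: dvdp_trans qr rp.
by rewrite ltn_neqAle eq_sym q1 size_poly_gt0.
Qed.

Lemma splitting_field_exists (F : fieldType) (p : {poly F}) : p != 0 ->
  exists (L : fieldExtType F) (zs : seq L),
    map_poly (in_alg L) p %= \prod_(z <- zs) ('X - z%:P).
Proof.
have [n] := ubnP (size p); elim: n => // n IH in F p *; rewrite ltnS => pn p0.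
have [p1|p1] := leqP (size p) 1.
  exists F^o, [::].
  by rewrite big_nil -size_poly_eq1 size_map_poly eqn_leq p1 size_poly_gt0.
have [r r_p irr_r] := irreducible_factor p1.
have [K _ [x rx0 _]] := irredp_FAdjoin irr_r.
have /factor_theorem[q Dp] : root (map_poly (in_alg K) p) x.
  by rewrite -(divpK r_p) rmorphM rootM /= rx0 orbT.
have sp : size p = size (q * ('X - x%:P)) by rewrite -Dp size_map_poly.
have q0 : q != 0.
  by move: p0; rewrite -size_poly_eq0 sp size_poly_eq0 mulf_eq0 => /norP[].
have [|L [zs Dq]] := IH K q _ q0.
  by move: pn; rewrite sp size_Mmonic ?monicXsubC // size_XsubC addn2.
have E : map_poly (in_alg (baseFieldType L)) p =
    map_poly (in_alg L) (map_poly (in_alg K) p).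
  by rewrite -map_poly_comp; apply: eq_map_poly => a /=; rewrite baseField_scaleE.
exists (baseFieldType L), (x%:A :: zs).
rewrite E big_cons Dp rmorphM /= mulrC rmorphB /= map_polyX map_polyC.
by rewrite eqp_mull.
Qed.

Definition vr_comap_mem (L M : fieldType) (g : {rmorphism L -> M})
  (w : valuation_ring M) : {pred L} := [pred z | g z \in w].

Fact vr_comap_subring (L M : fieldType) (g : {rmorphism L -> M})
  (w : valuation_ring M) : subring_closed (vr_comap_mem g w).
Proof.
split=> [|x y|x y]; rewrite !inE ?rmorph1 ?rmorphB ?rmorphM ?rpred1 //.
  exact: rpredB.
exact: rpredM.
Qed.

Fact vr_comap_total (L M : fieldType) (g : {rmorphism L -> M})
  (w : valuation_ring M) x :
  (x \in vr_comap_mem g w) || (x^-1 \in vr_comap_mem g w).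
Proof. by rewrite !inE fmorphV vr_total. Qed.

Definition vr_comap (L M : fieldType) (g : {rmorphism L -> M})
    (w : valuation_ring M) : valuation_ring L :=
  ValuationRing (vr_comap_subring g w) (vr_comap_total g w).

Lemma vr_comapE (L M : fieldType) (g : {rmorphism L -> M}) w x :
  (x \in vr_comap g w) = (g x \in w).
Proof. by []. Qed.

Lemma vmax_extends (K : fieldType) (v : valuation_ring K) (L : fieldExtType K)
  (w : valuation_ring L) x : vr_extends v w -> (x%:A \in vmax w) = (x \in vmax v).
Proof.
move=> vw; rewrite !vmaxE -(fmorph_eq0 (in_alg L)) /=; congr (_ || ~~ _).
by rewrite -vw; congr (_ \in w); rewrite -[x^-1%:A]/(in_alg L x^-1) fmorphV.
Qed.

Lemma vmax_poly (K : fieldType) (v : valuation_ring K) (E : {poly K}) x :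
  (forall i, E`_i \in vmax v) -> x \in v -> E.[x] \in vmax v.
Proof.
move=> Em xv; rewrite horner_coef rpred_sum // => i _.
by apply: vmaxMr => //; apply: rpredX.
Qed.

Section Henselian.

Variables (K : fieldType) (v : valuation_ring K).

(* With [f = X^(n+2) + X^(n+1) + E] and [E] infinitesimal, exactly one root [x]
   of [f] in a splitting field reduces to [-1]. A conjugate [y <> x] of [x]
   would give two different extensions of [v] to [K(x)]. *)
Lemma henselian_hensel : henselian_vr v -> hensel_axiom v.
Proof.
move=> hv n c cm; pose E := \poly_(i < n.+1) c i; pose f := 'X^(n.+2) + 'X^(n.+1) + E.
have Em i : E`_i \in vmax v by rewrite coef_poly; case: ifP => // _; apply: vmax0.
have sE : (size E < n.+3)%N by rewrite (leq_ltn_trans (size_poly _ _)) 1?ltnW.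
have fm : f \is monic.
  rewrite monicE /f -addrA lead_coefDl ?lead_coefXn // size_polyXn.
  by rewrite (leq_ltn_trans (size_polyD _ _)) // size_polyXn gtn_max !ltnS leqnn.
have fE b : f.[b] = b ^+ n.+2 + b ^+ n.+1 + \sum_(i < n.+1) c i * b ^+ i.
  by rewrite /f !hornerE horner_poly.
suff [b b1 fb] : exists2 b, b + 1 \in vmax v & f.[b] = 0 by exists b; rewrite -?fE.
have [L [zs fzs]] := splitting_field_exists (monic_neq0 fm).
set fL := map_poly (in_alg L) f in fzs.
have {}fzs : fL = \prod_(z <- zs) ('X - z%:P).
  by apply/eqP; rewrite -eqp_monic ?monic_map ?monic_prod_XsubC.
have [w [vw _]] := hv L.
pose EL := map_poly (in_alg L) E.
have ELm i : EL`_i \in vmax w by rewrite coef_map /= (vmax_extends _ vw).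
have fLE : fL = 'X^(n.+2) + 'X^(n.+1) + EL by rewrite /fL !rmorphD /= !map_polyXn.
have N1w : -1 \in w by rewrite rpredN rpred1.
(* For a root z outside [w], dividing the equation by z^(n+2) would write -1 as a sum of
   infinitesimals. *)
have zsw z : z \in zs -> z \in w.
  move=> zzs; apply: contraT => /[dup] zw /notin_vr_inv zVm.
  have z0 : z != 0 by apply: contraNneq zw => ->; apply: rpred0.
  have : fL.[z] = 0 by apply/rootP; rewrite fzs root_prod_XsubC.
  rewrite fLE !hornerE => /(congr1 (fun u => u * z^-1 ^+ n.+2)).
  rewrite mul0r !mulrDl -exprMn divff // expr1n.
  have -> : z ^+ n.+1 * z^-1 ^+ n.+2 = z^-1.
    by rewrite [z^-1 ^+ _]exprSr mulrA -exprMn divff // expr1n mul1r.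
  move/eqP; rewrite -addrA addr_eq0 => /eqP e1.
  have := vmax1 w; rewrite e1 rpredN rpredD //.
  have sEL : (size EL <= n.+2)%N by rewrite size_map_poly (leq_trans (size_poly _ _)).
  rewrite (horner_coef_wide _ sEL) mulr_suml rpred_sum // => i _.
  rewrite -mulrA; apply: vmaxMr => //.
  have -> : z^-1 ^+ n.+2 = z^-1 ^+ i * z^-1 ^+ (n.+2 - i)%N.
    by rewrite -exprD subnKC // ltnW.
  rewrite mulrA -exprMn divff // expr1n mul1r.
  by rewrite rpredX // vmax_sub.
have fN1 : fL.[-1] \in vmax w.
  have -> : fL.[-1] = EL.[-1].
    by rewrite fLE !hornerE exprS mulN1r addNr add0r.
  exact: vmax_poly.
have [x xzs x1] : exists2 x, x \in zs & x + 1 \in vmax w.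
  move: fN1; rewrite fzs horner_prod.
  elim: (zs) zsw => [|z s IH] sw; first by rewrite big_nil (negPf (vmax1 w)).
  have zw : z \in w by apply: sw; rewrite mem_head.
  rewrite big_cons => /vmax_prime/orP[||h].
  - by rewrite !hornerE -opprD addrC !(rpredN, rpredD) ?rpred1.
  - by rewrite !hornerE -opprD rpredN addrC; exists z; rewrite ?mem_head.
  have [|x xs ?] := IH _ h; first by move=> u us; apply: sw; rewrite inE us orbT.
  by exists x; rewrite // inE xs orbT.
pose zs' := rem x zs; pose G := \prod_(z <- zs') ('X - z%:P).
have fG : fL = ('X - x%:P) * G.
  by rewrite fzs (perm_big _ (perm_to_rem xzs)) big_cons.
have zs'w z : z \in zs' -> z \in w by move/mem_rem/zsw.
have prodw (t : seq L) : (forall z, z \in t -> z \in w) ->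
    \prod_(z <- t) ('X - z%:P) \is a polyOver w.
  move=> tw; rewrite big_seq; apply: rpred_prod => z /tw zw.
  by apply: rpredB; [exact: polyOverX | rewrite polyOverC].
(* The derivative at -1 is (-1)^(n+1) up to an infinitesimal, so -1 is a simple residual root and no
   other factor of [f] is infinitesimal there. *)
have f'N1 : fL^`().[-1] \notin vmax w.
  rewrite fLE 2!derivD !derivXn [n.+2.-1]/= [n.+1.-1]/= 2!hornerD !hornerMn !hornerXn.
  have -> : (-1) ^+ n.+1 *+ n.+2 + (-1) ^+ n *+ n.+1 = (-1) ^+ n.+1 :> L.
    by rewrite exprS mulN1r mulrS !mulNrn addrNK.
  rewrite rpredDr; first by apply: contra (vmaxN1 w); apply: vmaxX.
  by apply: vmax_poly => // i; rewrite coef_deriv rpredMn.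
have GN1 : G.[-1] \notin vmax w.
  apply: contra f'N1 => Gm; rewrite fG derivM !hornerE rpredD //.
    by rewrite derivXsubC hornerC mul1r.
  apply: vmaxMr; last by rewrite -opprD addrC rpredN.
  by apply: rpred_horner => //; apply/polyOver_deriv/prodw.
have ym y : y \in zs' -> y + 1 \notin vmax w.
  move=> yzs'; apply: contra GN1 => y1; rewrite /G (big_rem y) //= hornerM.
  apply: vmaxMr; last by rewrite !hornerE -opprD addrC rpredN.
  by apply: rpred_horner => //; apply: prodw => z /mem_rem/zs'w.
have [/vlineP[b xb]|x1K] := boolP (x \in 1%VS).
  exists b; first by rewrite -(vmax_extends _ vw) scalerDl scale1r -xb.
  apply/eqP; rewrite -(fmorph_eq0 (in_alg L)) -horner_map /= -xb -/fL.
  by rewrite -[_ == 0]/(root fL x) fzs root_prod_XsubC.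
(* Outside [K], [x] has a minimal polynomial of degree at least 2; its cofactor [g1] divides [G],
   hence has a root [y] among the remaining roots, none of which reduces to -1. *)
pose g := minPoly 1%AS x.
have gf : g %| fL.
  by apply: minPoly_dvdp; rewrite ?alg_polyOver // fzs root_prod_XsubC.
have /factor_theorem[g1 Dg] : root g x by apply: root_minPoly.
have g1G : g1 %| G.
  by move: gf; rewrite Dg fG mulrC dvdp_mul2l // polyXsubC_eq0.
have g0 : g1 != 0.
  by apply: contraTneq (monic_minPoly 1%AS x) => g10; rewrite -/g Dg g10 mul0r monicE lead_coef0 eq_sym oner_eq0.
have sg1 : size g1 != 1%N.
  have := size_minPoly 1%AS x; rewrite -/g Dg size_Mmonic ?monicXsubC //.
  rewrite size_XsubC addn2 => -[->]; by rewrite (adjoin_deg_eq1 1%AS x).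
have [m Dg1] := dvdp_prod_XsubC g1G.
have [y yzs' gy] : exists2 y, y \in zs' & root g y.
  case Dm : (mask m zs') Dg1 => [|y t] Dg1.
    by rewrite big_nil -size_poly_eq1 (negPf sg1) in Dg1.
  exists y; first by apply: (mem_mask (m := m)); rewrite Dm mem_head.
  by rewrite Dg rootM (eqp_root Dg1) big_cons rootM root_XsubC eqxx.
pose phi := kHomExtend 1%AS \1%VF x y.
have id1 : kHom 1%AS 1%AS (\1%VF : 'End(L)) by rewrite kHom1.
have gy1 : root (map_poly \1%VF (minPoly 1%AS x)) y.
  by rewrite (eq_map_poly (g := id)) ?map_poly_id // => z; rewrite id_lfunE.
have hphi : kHom 1%AS <<1; x>>%AS phi by apply: kHomExtendP.
pose i1 : {rmorphism subvs_of <<1; x>>%AS -> L} := vsval.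
pose i2 : {rmorphism subvs_of <<1; x>>%AS -> L} := kHom_rmorphism hphi.
have [w0 [_ w0u]] := hv (subvs_of <<1; x>>%AS).
have E1 : vr_comap i1 w =i w0.
  by apply: w0u => a; rewrite vr_comapE -vw; congr (_ \in w); apply: rmorph_alg.
have E2 : vr_comap i2 w =i w0.
  apply: w0u => a; rewrite vr_comapE -vw; congr (_ \in w).
  have /kHomP_tmp[idphi _] := hphi.
  by rewrite /= /kHom_rmorphism /= algid1 idphi ?rpredZ ?mem1v.
have xx : x \in <<1; x>>%VS by apply: memv_adjoin.
pose z := Subvs xx + 1.
have i1z : i1 z = x + 1 by rewrite rmorphD rmorph1.
have i2z : i2 z = y + 1.
  by rewrite rmorphD rmorph1; congr (_ + 1); apply: (kHomExtend_val id1 gy1).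
have /negP[] := ym _ yzs'; rewrite -i2z vmaxE fmorph_eq0 -fmorphV -vr_comapE E2 -E1.
by rewrite vr_comapE fmorphV -(fmorph_eq0 i1) i1z -vmaxE.
Qed.

End Henselian.

(** * Ultrapowers *)

Section Ultrapower.

Variables (I : Type) (K : fieldType) (U : set_system I) (UU : UltraFilter U).

(** The ultrafilter proof is kept in the type so that the ring instances can recover it: 1 <> 0 and
    the ideal of null functions depend on it. *)
Definition ufun (_ : UltraFilter U) : Type := I -> K.
Local Notation R := (ufun UU).

HB.instance Definition _ := gen_eqMixin (ufun UU).
HB.instance Definition _ := gen_choiceMixin (ufun UU).

Let uadd (x y : R) : R := fun i => x i + y i.
Let uopp (x : R) : R := fun i => - x i.
Let umul (x y : R) : R := fun i => x i * y i.

Fact uaddA : associative uadd.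
Proof. by move=> x y z; apply/funext => i; apply: addrA. Qed.
Fact uaddC : commutative uadd.
Proof. by move=> x y; apply/funext => i; apply: addrC. Qed.
Fact uadd0 : left_id (fun=> 0 : K) uadd.
Proof. by move=> x; apply/funext => i; apply: add0r. Qed.
Fact uaddN : left_inverse (fun=> 0 : K) uopp uadd.
Proof. by move=> x; apply/funext => i; apply: addNr. Qed.

HB.instance Definition _ := GRing.isZmodule.Build R uaddA uaddC uadd0 uaddN.

Fact umulA : associative umul.
Proof. by move=> x y z; apply/funext => i; apply: mulrA. Qed.
Fact umulC : commutative umul.
Proof. by move=> x y; apply/funext => i; apply: mulrC. Qed.
Fact umul1 : left_id (fun=> 1 : K) umul.
Proof. by move=> x; apply/funext => i; apply: mul1r. Qed.
Fact umulDl : left_distributive umul uadd.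
Proof. by move=> x y z; apply/funext => i; apply: mulrDl. Qed.
Fact uone_neq0 : (fun=> 1 : K) != 0 :> R.
Proof.
have [i _] := filter_ex (@filterT _ U _).
by apply/eqP => /(congr1 (fun x : R => x i)) /eqP; rewrite oner_eq0.
Qed.

HB.instance Definition _ := GRing.Zmodule_isComNzRing.Build R
  umulA umulC umul1 umulDl uone_neq0.

Definition uideal : {pred R} := [pred x | `[< U (fun i => x i = 0) >]].

Lemma uidealP (x : R) : reflect (U (fun i => x i = 0)) (x \in uideal).
Proof. exact: asboolP. Qed.

Fact uideal_closed : idealr_closed uideal.
Proof.
split; first by apply/uidealP; apply: filterS (@filterT _ U _).
  by apply/uidealP => /filter_ex[i /eqP]; rewrite oner_eq0.
move=> a x y /uidealP xU /uidealP yU; apply/uidealP.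
apply: filterS2 xU yU => i /= x0 y0.
by rewrite -[LHS]/(a i * x i + y i) x0 y0 mulr0 addr0.
Qed.

HB.instance Definition _ := isIdealr.Build R uideal uideal_closed.

Definition upow : Type := {ideal_quot uideal}.

HB.instance Definition _ := GRing.ComNzRing.on upow.

Definition ucls (x : I -> K) : upow := (\pi_({ideal_quot uideal}) (x : R))%qT.
Definition urep (u : upow) : I -> K := repr (u : {ideal_quot uideal}).

Lemma urepK u : ucls (urep u) = u.
Proof. exact: reprK. Qed.

Lemma ucls_eq x y : ucls x = ucls y <-> U (fun i => x i = y i).
Proof.
split=> [xy|xy].
  have /uidealP : (x : R) - (y : R) \in uideal.
    by rewrite Quotient.idealrBE; apply/eqP.
  by apply: filterS => i xyi; apply/eqP; rewrite -subr_eq0; apply/eqP/xyi.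
apply/eqP; rewrite /ucls -[_ == _]Quotient.idealrBE; apply/uidealP.
by apply: filterS xy => i xy; rewrite -[LHS]/(x i - y i) xy subrr.
Qed.

Lemma urep_ucls x : U (fun i => urep (ucls x) i = x i).
Proof. by apply/ucls_eq; rewrite urepK. Qed.

Lemma ucls0 : ucls (fun=> 0) = 0. Proof. exact: (rmorph0 (\pi_({ideal_quot uideal}))%qT). Qed.
Lemma ucls1 : ucls (fun=> 1) = 1. Proof. exact: rmorph1. Qed.
Lemma uclsN x : ucls (fun i => - x i) = - ucls x. Proof. exact: rmorphN. Qed.
Lemma uclsD x y : ucls (fun i => x i + y i) = ucls x + ucls y.
Proof. exact: rmorphD. Qed.
Lemma uclsM x y : ucls (fun i => x i * y i) = ucls x * ucls y.
Proof. exact: rmorphM. Qed.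

Definition uinv (u : upow) : upow := ucls (fun i => (urep u i)^-1).

Fact umulVf u : u != 0 -> uinv u * u = 1.
Proof.
move=> u0; rewrite -{2}[u]urepK -uclsM -ucls1; apply/ucls_eq.
have [u0U|] := in_ultra_setVsetC (fun i => urep u i = 0) UU.
  by case/eqP: u0; rewrite -[u]urepK -ucls0; apply/ucls_eq.
by apply: filterS => i /eqP ui; rewrite mulVf.
Qed.

Fact uinv0 : uinv 0 = 0.
Proof.
rewrite /uinv -{2}ucls0; apply/ucls_eq.
have : U (fun i => urep 0 i = 0) by apply/ucls_eq; rewrite urepK ucls0.
by apply: filterS => i ->; rewrite invr0.
Qed.

HB.instance Definition _ := GRing.ComNzRing_isField.Build upow umulVf uinv0.

Lemma ultra_or (P Q : I -> Prop) : U (fun i => P i \/ Q i) <-> U P \/ U Q.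
Proof.
split=> [PQ|[]]; [|by apply: filterS; left|by apply: filterS; right].
have [|nP] := in_ultra_setVsetC P UU; first by left.
by right; apply: filterS2 PQ nP => i [].
Qed.

Lemma ultra_not (P : I -> Prop) : U (fun i => ~ P i) <-> ~ U P.
Proof.
split=> [nP PU|nP]; last by have [] := in_ultra_setVsetC P UU.
by have /filter_ex[i []] : U (fun i => ~ P i /\ P i) by apply: filterI.
Qed.

Lemma ultra_and (P Q : I -> Prop) : U (fun i => P i /\ Q i) <-> U P /\ U Q.
Proof.
split=> [PQ|[]]; last exact: filterI.
by split; apply: filterS PQ => i [].
Qed.

Lemma eval_ucls n (e : n.-tuple (I -> K)) (t : ring_term n) :
  eval_term (map_tuple ucls e) t =
  ucls (fun i => eval_term (map_tuple (fun x => x i) e) t).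
Proof.
elim: t => /= [j|||t ->|t -> u ->|t -> u ->].
- by rewrite tnth_map; congr ucls; apply/funext => i; rewrite tnth_map.
- by rewrite ucls0.
- by rewrite ucls1.
- by rewrite uclsN.
- by rewrite uclsD.
- by rewrite uclsM.
Qed.

(** In the quantifier cases witnesses, or counterexamples, are chosen index by index and assembled
    into one element of the ultrapower. *)
Lemma ultra_Los n (f : ring_formula n) (e : n.-tuple (I -> K)) :
  holds (map_tuple ucls e) f <-> U (fun i => holds (map_tuple (fun x => x i) e) f).
Proof.
elim: f e => /= [{}n t1 t2|{}n f IH|{}n f IHf g IHg|{}n f IHf g IHg|{}n f IH|{}n f IH] e.
- by rewrite !eval_ucls; apply: ucls_eq.
- by rewrite IH ultra_not.
- by rewrite IHf IHg ultra_and.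
- by rewrite IHf IHg ultra_or.
- split=> [[x]|he].
    rewrite -[x]urepK -cons_tuple_map IH; apply: filterS => i hi.
    by exists (urep x i); rewrite cons_tuple_map in hi.
  have /choice[x hx] i : exists x, holds [tuple of x :: map_tuple (fun y => y i) e] f
      \/ ~ exists x, holds [tuple of x :: map_tuple (fun y => y i) e] f.
    by case: (pselect (exists x, holds [tuple of x :: map_tuple (fun y => y i) e] f))
      => [[x hx]|nx]; [exists x; left|exists 0; right].
  exists (ucls x); rewrite -cons_tuple_map IH; apply: filterS he => i hi.
  by rewrite cons_tuple_map; have [] := hx i.
- split=> [he|he x].
    apply: contrapT => /ultra_not nh.
    have /choice[x hx] i : exists x, ~ holds [tuple of x :: map_tuple (fun y => y i) e] f
        \/ forall x, holds [tuple of x :: map_tuple (fun y => y i) e] f.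
      case: (pselect (exists x, ~ holds [tuple of x :: map_tuple (fun y => y i) e] f)).
        by move=> [x hx]; exists x; left.
      by move=> nx; exists 0; right => x; apply: contrapT => ?; apply: nx; exists x.
    have := he (ucls x); rewrite -cons_tuple_map IH => xU.
    have [i [h1 h2]] := filter_ex (filterI nh xU).
    by rewrite cons_tuple_map in h2; have [|/h1] := hx i.
  rewrite -[x]urepK -cons_tuple_map IH; apply: filterS he => i hi.
  by rewrite cons_tuple_map.
Qed.

Lemma upow_elem_equiv : elem_equiv K upow.
Proof.
move=> phi; rewrite /satisfies -(tuple0_eq (map_tuple ucls [tuple])).
rewrite ultra_Los; split=> [h|/filter_ex[i]].
  by apply: filterS (@filterT _ U _) => i _; rewrite [map_tuple _ _]tuple0_eq.
by rewrite [map_tuple _ _]tuple0_eq.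
Qed.

Section UltrapowerValuation.

Variable v : valuation_ring K.

Lemma ultra_rep (P : K -> Prop) x :
  U (fun i => P (urep (ucls x) i)) <-> U (fun i => P (x i)).
Proof. by split; apply: filterS2 (urep_ucls x) => i ->. Qed.

Definition uval_mem : {pred upow} := [pred u | `[< U (fun i => urep u i \in v) >]].

Lemma uval_memP x : reflect (U (fun i => x i \in v)) (ucls x \in uval_mem).
Proof.
apply: (iffP (asboolP _)) => h; first exact/(ultra_rep (fun z => z \in v)).
exact/(ultra_rep (fun z => z \in v)).
Qed.

Fact uval_subring : subring_closed uval_mem.
Proof.
split.
- rewrite -ucls1; apply/uval_memP; apply: filterS (@filterT _ U _) => i _.
  exact: rpred1.
- move=> x y; rewrite -[x]urepK -[y]urepK -uclsN -uclsD => /uval_memP xv /uval_memP yv.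
  by apply/uval_memP; apply: filterS2 xv yv => i ? ?; apply: rpredB.
- move=> x y; rewrite -[x]urepK -[y]urepK -uclsM => /uval_memP xv /uval_memP yv.
  by apply/uval_memP; apply: filterS2 xv yv => i ? ?; apply: rpredM.
Qed.

Lemma uclsV x : ucls (fun i => (x i)^-1) = (ucls x)^-1.
Proof.
by rewrite -[RHS]/(uinv _); apply/ucls_eq; apply: filterS (urep_ucls x) => i ->.
Qed.

Fact uval_total x : (x \in uval_mem) || (x^-1 \in uval_mem).
Proof.
rewrite -[x]urepK -uclsV; apply/orP.
suff : U (fun i => urep x i \in v \/ (urep x i)^-1 \in v).
  by case/ultra_or => h; [left|right]; apply/uval_memP.
by apply: filterS (@filterT _ U _) => i _; apply/orP/vr_total.
Qed.

Definition uval : valuation_ring upow := ValuationRing uval_subring uval_total.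

Lemma uvalP x : reflect (U (fun i => x i \in v)) (ucls x \in uval).
Proof. exact: uval_memP. Qed.

Lemma uvmaxP x : reflect (U (fun i => x i \in vmax v)) (ucls x \in vmax uval).
Proof.
apply: (iffP idP).
  rewrite vmaxE -uclsV => /predU1P[|/uvalP/ultra_not].
    by rewrite -ucls0 => /ucls_eq; apply: filterS => i ->; apply: vmax0.
  by apply: filterS => i /negP; rewrite -{2}[x i]invrK; apply: notin_vr_inv.
move=> xm; rewrite vmaxE; have [//|x0 /=] := eqVneq (ucls x) 0.
rewrite -uclsV; apply/uvalP/ultra_not.
have /ultra_not : ~ U (fun i => x i = 0).
  by move=> xU; case/eqP: x0; rewrite -ucls0; apply/ucls_eq.
apply: filterS2 xm => i + /eqP xi0; rewrite vmaxE (negPf xi0) /=.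
by move/negP.
Qed.

Lemma ucls_sum n (F : 'I_n -> I -> K) :
  ucls (fun i => \sum_(j < n) F j i) = \sum_(j < n) ucls (F j).
Proof.
elim: n F => [|n IH] F.
  by rewrite big_ord0 -ucls0; congr ucls; apply/funext => i; rewrite big_ord0.
rewrite big_ord_recl -IH -uclsD; congr ucls.
by apply/funext => i; rewrite big_ord_recl.
Qed.

Lemma uclsX x n : ucls (fun i => x i ^+ n) = ucls x ^+ n.
Proof.
elim: n => [|n IH]; first by rewrite expr0 -ucls1.
by rewrite exprS -IH -uclsM; congr ucls; apply/funext => i; rewrite exprS.
Qed.

Lemma uval_hensel : hensel_axiom v -> hensel_axiom uval.
Proof.
move=> hv n c cm; pose cr j i := urep (c j) i.
have /choice[b hb] i : exists b, (forall j : 'I_n.+1, cr j i \in vmax v) ->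
    b + 1 \in vmax v /\ b ^+ n.+2 + b ^+ n.+1 + \sum_(j < n.+1) cr j i * b ^+ j = 0.
  case: (pselect (forall j : 'I_n.+1, cr j i \in vmax v)) => [cv|ncv]; last by exists 0.
  (* The axiom asks for a whole sequence of infinitesimals, but only finitely many conditions hold
     simultaneously on a large set; coefficients beyond degree n are set to 0. *)
  have [|b b1 be] := hv n (fun j => if (j < n.+1)%N then cr j i else 0).
    by move=> j; case: ifP => [jn|_]; [apply: (cv (Ordinal jn))|apply: vmax0].
  by exists b; split=> //; rewrite -[RHS]be; congr (_ + _); apply: eq_bigr => j _; rewrite ltn_ord.
have crU : U (fun i => forall j : 'I_n.+1, cr j i \in vmax v).
  have : forall j : 'I_n.+1, U (fun i => cr j i \in vmax v).
    by move=> j; apply/uvmaxP; rewrite urepK.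
  elim: n.+1 {hb} => [|m IH] h; first by apply: filterS (@filterT _ U _) => i _ [].
  have {IH}hm := IH (fun j => h (widen_ord (leqnSn m) j)).
  apply: filterS2 (h ord_max) hm => i h1 h2 j.
  by case: (unliftP ord_max j) => [j' ->|->]; rewrite // lift_max.
exists (ucls b).
  rewrite -ucls1 -uclsD; apply/uvmaxP; apply: filterS crU => i /hb[]//.
rewrite -!uclsX (eq_bigr (fun j : 'I_n.+1 => ucls (fun i => cr j i * b i ^+ j))).
  rewrite -ucls_sum -!uclsD -ucls0; apply/ucls_eq.
  by apply: filterS crU => i /hb[].
by move=> j _; rewrite uclsM uclsX urepK.
Qed.

End UltrapowerValuation.
End Ultrapower.

Lemma ultra_of_base (I J : Type) (j0 : J) (S : J -> I -> Prop) :
  (forall a b, exists c, forall i, S c i -> S a i /\ S b i) ->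
  (forall a, exists i, S a i) ->
  exists2 U : set_system I, UltraFilter U & forall a, U (S a).
Proof.
move=> Sdir Sne; pose F : set_system I := fun P => exists a, forall i, S a i -> P i.
have FF : ProperFilter F.
  split; first by move=> [a Sa]; have [i /Sa] := Sne a.
  split; first by exists j0.
    move=> P Q [a Pa] [b Qb]; have [c hc] := Sdir a b.
    by exists c => i /hc[/Pa ? /Qb].
  by move=> P Q PQ [a Pa]; exists a => i /Pa/PQ.
have [U [UU FU]] := ultraFilterLemma FF.
by exists U => // a; apply: FU; exists a.
Qed.

(** * Embeddings into ultrapowers from inclusions of existential theories *)

Section Embedding.

Variables F K : fieldType.

Definition partial_morph (s : seq F) (g : F -> K) :=
  g 1 = 1 /\ forall a b, a \in s -> b \in s ->
    g (a + b) = g a + g b /\ g (a * b) = g a * g b.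

(** The addition and multiplication tables of a finite set form a quantifier-free formula, whose
    existential closure passes from [F] to [K]. *)
Lemma partial_morph_exists (s : seq F) :
  (Th_ex F `<=` Th_ex K)%classic -> exists g, partial_morph s g.
Proof.
move=> FK.
(* Each element of [t] gets a variable; sums and products are included so that every table entry
   over [s] is an equation between variables. *)
pose t := undup (1 :: s ++ [seq a + b | a <- s, b <- s] ++ [seq a * b | a <- s, b <- s]).
set n := size t; pose T := FEq (TZero n) (TZero n).
pose X := @TVar n; pose at_ (i : 'I_n) := t`_i.
pose phi (x : 'I_n * 'I_n * 'I_n) := let: (i, j, l) := x in
  FAnd (if at_ i + at_ j == at_ l then FEq (TAdd (X i) (X j)) (X l) else T)
    (FAnd (if at_ i * at_ j == at_ l then FEq (TMul (X i) (X j)) (X l) else T)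
       (if at_ i == 1 then FEq (X i) (TOne n) else T)).
pose psi := conj_formula [seq phi x | x <- enum {: 'I_n * 'I_n * 'I_n}].
have psi_ex : existential psi.
  apply/existential_qf/conj_formula_qf; rewrite all_map; apply/allP => -[[i j] l] _ /=.
  by do 3 case: ifP.
have psiF : satisfies F (ex_closure psi).
  apply/satisfies_closure; exists (in_tuple t); apply/holds_conj => -[[i j] l] _ /=.
  by split; last split; case: ifP => //= /eqP; rewrite !(tnth_nth 0).
have [psiK _] := FK _ (conj psiF (existential_closure psi_ex)).
have [e /holds_conj he] := (satisfies_closure K psi).1 psiK.
pose g a := e`_(index a t); exists g.
have gE a (at' : a \in t) : exists2 i : 'I_n, at_ i = a & g a = tnth e i.
  have ai : (index a t < n)%N by rewrite index_mem.
  by exists (Ordinal ai); [rewrite /at_ nth_index | rewrite (tnth_nth 0)].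
have t1 : 1 \in t by rewrite mem_undup mem_head.
split.
  have [i ai ->] := gE _ t1.
  have [_ [_]] := he (i, i, i) (mem_enum _ _).
  by rewrite ai eqxx.
move=> a b as_ bs.
have at' : a \in t by rewrite mem_undup inE mem_cat as_ orbT.
have bt : b \in t by rewrite mem_undup inE mem_cat bs orbT.
have [i ai ->] := gE _ at'; have [j bj ->] := gE _ bt.
split.
  have [|l al ->] := gE (a + b).
    by rewrite mem_undup inE !mem_cat (allpairs_f (fun x y => x + y)) // !orbT.
  have [+ _] := he (i, j, l) (mem_enum _ _).
  by rewrite ai bj al eqxx.
have [|l al ->] := gE (a * b).
  by rewrite mem_undup inE !mem_cat (allpairs_f (fun x y => x * y)) // !orbT.
have [_ [+ _]] := he (i, j, l) (mem_enum _ _).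
by rewrite ai bj al eqxx.
Qed.

(** The index set is the set of all functions F -> K, with an ultrafilter containing
    [partial_morph s] for every finite [s]; an element of [F] goes to the class of evaluation at
    it. *)
Lemma ultrapower_embedding : (Th_ex F `<=` Th_ex K)%classic ->
  exists (I : Type) (U : set_system I) (UU : UltraFilter U),
    inhabited {rmorphism F -> upow K UU}.
Proof.
move=> FK; have [|s|U UU SU] := @ultra_of_base (F -> K) (seq F) [::] partial_morph.
- move=> s t; exists (s ++ t) => g [g1 gst]; split; split=> // a b ha hb;
    by apply: gst; rewrite mem_cat ?ha ?hb ?orbT.
- exact: partial_morph_exists.
exists (F -> K), U, UU.
pose h (a : F) : upow K UU := ucls UU (fun g => g a).
have hB : zmod_morphism h.
  move=> x y; apply/eqP; rewrite eq_sym subr_eq; apply/eqP; rewrite /h -uclsD.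
  (* Partial morphisms respect sums only, hence the detour through x = (x - y) + y. *)
  apply/ucls_eq; apply: filterS (SU [:: x - y; y]) => g [_ gs].
  by have [||<- _] := gs (x - y) y; rewrite ?subrK // !inE eqxx ?orbT.
have hM : monoid_morphism h.
  split=> [|x y].
    rewrite /h -ucls1; apply/ucls_eq; apply: filterS (SU [::]) => g [g1 _] //.
  rewrite /h -uclsM; apply/ucls_eq; apply: filterS (SU [:: x; y]) => g [_ gs].
  by have [||_ <-] := gs x y; rewrite // !inE eqxx ?orbT.
by constructor; exact: (HB.pack h (GRing.isZmodMorphism.Build _ _ _ hB)
  (GRing.isMonoidMorphism.Build _ _ _ hM)).
Qed.

End Embedding.

(** * Laurent series over a subfield of a henselian field *)

Lemma fraction_repr (R : idomainType) (x : {fraction R}) :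
  exists a b, b != 0 /\ x = tofrac a / tofrac b.
Proof.
elim/quotW: x => y; exists \n_y, \d_y; have y0 := denom_ratioP y; split=> //.
apply/esym/(canLR (mulfK _)); first by rewrite tofrac_eq0.
rewrite !piE; apply/eqmodP.
rewrite /= FracField.equivfE /FracField.mulf !numden_Ratio ?mulf_neq0 ?oner_eq0 //.
by rewrite !mulr1 mul1r.
Qed.

Section ResidualFraction.

Variables (K : fieldType) (W : valuation_ring K).

Lemma vmax_sub_div u u' w w' : u \in W -> w \in W -> w \notin vmax W ->
  u - u' \in vmax W -> w - w' \in vmax W -> u / w - u' / w' \in vmax W.
Proof.
move=> uW wW wm uu ww; have w'm : w' \notin vmax W by rewrite -(vmax_congr ww).
have w0 := notin_vmax_neq0 wm; have w'0 := notin_vmax_neq0 w'm.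
have -> : u / w - u' / w' = ((u - u') * w - u * (w - w')) * (w^-1 * w'^-1).
  by field; rewrite w0 w'0.
apply: vmaxMr; first by rewrite rpredM ?notin_vmax_inv.
by apply: rpredB; [apply: vmaxMr|apply: vmaxMl].
Qed.

Lemma residual_nat (k : nzRingType) (theta : k -> K) n :
  residual_map W theta -> theta n%:R - n%:R \in vmax W.
Proof.
move=> th; elim: n => [|n IH]; first by rewrite subr0 res_0.
rewrite -natr1 -[in X in _ - X]natr1; apply: vmax_trans (res_D th _ _) _.
by rewrite opprD addrACA rpredD ?(res_1 th).
Qed.

(** Nonzero elements of [R] go to units of [W], so theta(a) / theta(b) depends, modulo the maximal
    ideal, only on the fraction a / b. This is [key], and it lets representatives be chosen
    arbitrarily. *)
Lemma residual_fraction (R : idomainType) (theta : R -> K) :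
  residual_map W theta -> (forall a, a != 0 -> theta a \notin vmax W) ->
  exists theta' : {fraction R} -> K, residual_map W theta'.
Proof.
move=> th th0; have thW := res_mem th.
have /choice[rep repP] (x : {fraction R}) : exists p : R * R,
    p.2 != 0 /\ x = tofrac p.1 / tofrac p.2.
  by have [a [b ab]] := fraction_repr x; exists (a, b).
pose theta' x := theta (rep x).1 / theta (rep x).2; exists theta'.
have thV b : b != 0 -> (theta b)^-1 \in W by move=> b0; rewrite notin_vmax_inv // th0.
have key x a b : b != 0 -> x = tofrac a / tofrac b ->
    theta' x - theta a / theta b \in vmax W.
  move=> b0 xab; rewrite /theta'; have [p0] := repP x.
  move: (rep x) p0 => -[a' b'] /= b'0 /eqP.
  rewrite xab eqr_div ?tofrac_eq0 // -!tofracM tofrac_eq => /eqP E.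
  have -> : theta a' / theta b' - theta a / theta b =
      (theta a' * theta b - theta a * theta b') * ((theta b)^-1 * (theta b')^-1).
    by field; rewrite !(notin_vmax_neq0 (th0 _ _)).
  apply: vmaxMr; first by rewrite rpredM // thV.
  apply: (vmax_trans (y := theta (a' * b))); last by rewrite -E (res_M th).
  by rewrite -opprB rpredN (res_M th).
split.
- by move=> x; have [x0 _] := repP x; rewrite rpredM // thV.
- have := key 1 1 1 (oner_neq0 _); rewrite tofrac1 divr1 => /(_ erefl).
  by rewrite divff // (notin_vmax_neq0 (th0 _ (oner_neq0 _))).
- move=> x y; have [x0 xE] := repP x; have [y0 yE] := repP y; rewrite /theta'.
  move: (rep x) (rep y) x0 y0 xE yE => -[a b] [c d] /= b0 d0 xE yE.
  apply: vmax_trans (key _ (a * d + c * b) (b * d) _ _) _.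
  + exact: mulf_neq0.
  + by rewrite xE yE tofracD !tofracM addf_div ?tofrac_eq0.
  rewrite addf_div ?(notin_vmax_neq0 (th0 _ _)) //.
  apply: vmax_sub_div => //; rewrite ?th0 ?mulf_neq0 //; last exact: (res_M th).
  apply: vmax_trans (res_D th _ _) _.
  by rewrite opprD addrACA rpredD // (res_M th).
move=> x y; have [x0 xE] := repP x; have [y0 yE] := repP y; rewrite /theta'.
move: (rep x) (rep y) x0 y0 xE yE => -[a b] [c d] /= b0 d0 xE yE.
apply: vmax_trans (key _ (a * c) (b * d) _ _) _.
- exact: mulf_neq0.
- by rewrite xE yE !tofracM mulf_div.
rewrite mulf_div.
by apply: vmax_sub_div => //; rewrite ?th0 ?mulf_neq0 // (res_M th).
Qed.

End ResidualFraction.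

Lemma ps_neq0 (R : comNzRingType) (a : power_series R) : a != 0 -> exists m, pscoef a m != 0.
Proof.
move=> a0; apply: contrapT => h; case/eqP: a0; apply: psP => n /=.
by apply: contrapT => /eqP an; apply: h; exists n.
Qed.

Section LaurentTransfer.

Variables (F K : fieldType) (v : valuation_ring K) (sigma : {rmorphism F -> K}).

(** With p = (e, n0) and i = (d, n), d is infinitesimal against e(n). Where e(n) = 0 the convention
    0^-1 = 0 voids this condition. *)
Definition lt_base (p : (nat -> K) * nat) (i : K * nat) :=
  [/\ (p.2 <= i.2)%N, i.1 != 0 & i.1 / p.1 i.2 \in vmax v].

Lemma lt_base_directed p q :
  exists r, forall i, lt_base r i -> lt_base p i /\ lt_base q i.
Proof.
(* Pointwise the smaller of the two bounds, a zero entry counting as no bound. *)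
exists (fun n => if (p.1 n / q.1 n \in v) && (p.1 n != 0) then p.1 n else q.1 n,
        maxn p.2 q.2).
case=> d n [/=]; rewrite geq_max => /andP[pn qn] d0.
case: ifP => [/andP[pq p0]|/negbT].
  move=> dp; split; split=> //=.
  have -> : d / q.1 n = d / p.1 n * (p.1 n / q.1 n) by rewrite mulrA divfK.
  exact: vmaxMr.
rewrite negb_and negbK => h dq; split; split=> //=.
have [->|p0] := eqVneq (p.1 n) 0; first by rewrite invr0 mulr0 vmax0.
rewrite (negPf p0) orbF in h.
have q0 : q.1 n != 0 by apply: contraNneq h => ->; rewrite invr0 mulr0 rpred0.
have -> : d / p.1 n = d / q.1 n * (p.1 n / q.1 n)^-1.
  by rewrite invf_div mulrA divfK.
by apply: vmaxMr => //; apply/vmax_sub/notin_vr_inv.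
Qed.

Lemma lt_base_nonempty : nontrivial_vr v -> forall p, exists i, lt_base p i.
Proof.
move=> [x xv] [e n]; have x0 : x != 0 by apply: contraNneq xv => ->; apply: rpred0.
exists (if e n == 0 then x^-1 else e n * x^-1, n); split=> //=.
  have [_|e0] := eqVneq (e n) 0; first by rewrite invr_eq0.
  by apply: mulf_neq0; rewrite // invr_eq0.
have [->|e0] := eqVneq (e n) 0; first by rewrite invr0 mulr0 vmax0.
by rewrite mulrAC divff // mul1r notin_vr_inv.
Qed.

(** Gives the bound e(n) of [lt_base]: whatever is infinitesimal against it stays infinitesimal when
    multiplied by any of the first n coefficients. *)
Lemma common_denominator (a : nat -> K) n :
  exists e, [/\ e != 0, e \in v & forall j, (j < n)%N -> e * a j \in v].
Proof.
elim: n => [|n [e [e0 ev he]]]; first by exists 1; rewrite oner_neq0 rpred1.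
pose u := if a n \in v then 1 else (a n)^-1.
have uv : u \in v.
  by rewrite /u; case: ifP => [_|/negbT]; [rewrite rpred1 | move/notin_vr_inv/vmax_sub].
have u0 : u != 0.
  rewrite /u; case: ifP => [_|/negbT anv]; first exact: oner_neq0.
  by rewrite invr_eq0; apply: contraNneq anv => ->; apply: rpred0.
exists (e * u); split=> [||j]; [exact: mulf_neq0 | exact: rpredM | ].
rewrite ltnS leq_eqVlt => /predU1P[->|/he ej]; last by rewrite mulrAC rpredM.
rewrite -mulrA rpredM // /u; case: ifP => [|_]; first by rewrite mul1r.
by have [->|an0] := eqVneq (a n) 0; rewrite ?mulr0 ?rpred0 // mulVf // rpred1.
Qed.

(** [P] will be a truncated product minus a product of truncations. Its coefficients involve
    products of two coefficients, whose denominators cost d^2, whence [m.+2]. *)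
Lemma horner_small (P : {poly K}) d n m : d \in v -> d != 0 -> (m.+2 <= n)%N ->
  (forall l, (l < n)%N -> P`_l = 0) -> (forall l, d ^+ 2 * P`_l \in v) ->
  P.[d] / d ^+ m \in v.
Proof.
move=> dv d0 mn P0 Pv; rewrite horner_coef mulr_suml rpred_sum // => l _.
have [ln|nl] := ltnP l n; first by rewrite P0 // !mul0r rpred0.
have -> : P`_l * d ^+ l / d ^+ m = d ^+ 2 * P`_l * d ^+ (l - m.+2).
  have -> : d ^+ l = d ^+ m * d ^+ 2 * d ^+ (l - m.+2).
    by rewrite -!exprD; congr (_ ^+ _); lia.
  by rewrite ![_ * P`_l]mulrC; field; rewrite expf_neq0.
by rewrite rpredM // rpredX.
Qed.

(* Index the ultrapower by pairs [(d, n)] where [d] is eventually smaller than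
   any prescribed function of [n]; the truncation at order [n] evaluated at [d]
   then depends multiplicatively on the power series modulo all powers of the
   class of [d]. *)
Lemma Th_ex_laurent_henselian :
  hensel_axiom v -> nontrivial_vr v -> (Th_ex (laurent_series F) `<=` Th_ex K)%classic.
Proof.
move=> hv ntv.
have [U UU baseU] :=
  ultra_of_base ((fun=> 1) : nat -> K, 0%N) lt_base_directed (lt_base_nonempty ntv).
have good (a : nat -> F) n0 : U (fun i => [/\ (n0 <= i.2)%N, i.1 != 0, i.1 \in vmax v &
    forall j, (j < i.2)%N -> i.1 * sigma (a j) \in vmax v]).
  have /choice[e he] n := common_denominator (fun j => sigma (a j)) n.
  apply: filterS (baseU (e, n0)) => -[d n] [/= n0n d0 dm].
  have [e0 ev ea] := he n; split=> //=; first by rewrite -(divfK e0 d); apply: vmaxMr.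
  move=> j /ea aj; have -> : d * sigma (a j) = d / e n * (e n * sigma (a j)).
    by rewrite mulrA divfK.
  exact: vmaxMr.
pose c := ucls UU (fun i => i.1).
pose KU := upow K UU; pose vU := uval UU v.
have cm : c \in vmax vU.
  by apply/uvmaxP; apply: filterS (good (fun=> 0) 0%N) => i [].
have cv := vmax_sub cm.
have c0 : c != 0.
  apply/eqP; rewrite -(ucls0 K UU) => /ucls_eq.
  by apply/ultra_not; apply: filterS (good (fun=> 0) 0%N) => i [_ /eqP].
(* [W] is the localization of [vU] at c. It contains the constants from [F], whose products with c
   are infinitesimal. *)
pose Wmem : {pred KU} := [pred u | `[< exists m, c ^+ m * u \in vU >]].
have vW u : u \in vU -> u \in Wmem by move=> uv; apply/asboolP; exists 0%N; rewrite mul1r.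
have W_subring : subring_closed Wmem.
  split; first by apply: vW; apply: rpred1.
    move=> x y /asboolP[m xm] /asboolP[n yn]; apply/asboolP; exists (m + n)%N.
    rewrite mulrBr; apply: rpredB; rewrite exprD; first by rewrite mulrAC rpredM ?rpredX.
    by rewrite -mulrA rpredM ?rpredX.
  move=> x y /asboolP[m xm] /asboolP[n yn]; apply/asboolP; exists (m + n)%N.
  by rewrite exprD mulrACA rpredM.
have W_total x : (x \in Wmem) || (x^-1 \in Wmem).
  by have /orP[/vW ->//|/vW ->] := vr_total vU x; rewrite orbT.
pose W := ValuationRing W_subring W_total.
have WP x : x \in W <-> exists m, c ^+ m * x \in vU by split=> [/asboolP|h] //; apply/asboolP.
have vWs : {subset vU <= W} by [].
have WmP x : x \in vmax W <-> forall m, x / c ^+ m \in vU.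
  split=> [|h].
    rewrite vmaxE => /predU1P[-> m|xW m]; first by rewrite mul0r rpred0.
    apply: contraNT xW => xm; apply/WP; exists m.
    by rewrite -[c ^+ m * _]invrK vmax_sub // notin_vr_inv // invfM invrK mulrC.
  rewrite vmaxE; have [//|x0 /=] := eqVneq x 0.
  apply/negP => /WP[m xm]; have := cm; rewrite vmaxE (negPf c0) /=.
  have -> : c^-1 = c ^+ m / x * (x / c ^+ m.+1).
    by rewrite mulrA divfK // exprS invfM mulrCA divff ?mulr1 // expf_neq0.
  by move/negP; apply; apply: (rpredM xm (h m.+1)).
pose tr n (a : power_series F) := map_poly sigma (ps_trunc n a).
have trE n a j : (tr n a)`_j = if (j < n)%N then sigma (pscoef a j) else 0.
  rewrite coef_map /= coef_poly; case: ltnP => _ //; exact: rmorph0.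
have str n a : (size (tr n a) <= n)%N by rewrite size_map_poly size_poly.
pose theta (a : power_series F) : KU := ucls UU (fun i => (tr i.2 a).[i.1]).
have th : residual_map W theta.
  split.
  - move=> a; apply/WP; exists 1%N; rewrite expr1 -uclsM; apply/uvalP.
    apply: filterS (good (pscoef a) 0%N) => -[d n] [/= _ d0 dm da].
    rewrite horner_coef mulr_sumr rpred_sum // => j _; rewrite mulrA trE.
    rewrite rpredM ?rpredX ?vmax_sub //; case: ifP => [/da|_]; first exact: id.
    by rewrite mulr0 vmax0.
  - suff -> : theta 1 = 1 by rewrite subrr vmax0.
    rewrite -(ucls1 K UU); apply/ucls_eq.
    apply: filterS (good (fun=> 0) 1%N) => -[d n] [/= n0 _ _ _].
    rewrite (_ : tr n 1 = 1) ?hornerC //; apply/polyP => j; rewrite trE coef1.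
    by case: ltnP => jn; [rewrite /= rmorph_nat | rewrite gtn_eqF // (leq_trans n0)].
  - move=> a b; suff -> : theta (a + b) = theta a + theta b by rewrite subrr vmax0.
    rewrite -uclsD; congr ucls; apply/funext => -[d n] /=; rewrite -hornerD; congr _.[_].
    by apply/polyP => j; rewrite coefD !trE; case: ifP; rewrite ?addr0 // -rmorphD.
  (* Addition is respected exactly, multiplication only here: the discrepancy starts in degree n,
     and n >= m + 2 almost everywhere, so it is divisible by every power of c. *)
  move=> a b; apply/WmP => m.
  rewrite -uclsM -uclsN -uclsD -uclsX -uclsV -uclsM; apply/uvalP.
  apply: filterS2 (good (pscoef a) m.+2) (good (pscoef b) m.+2).
  move=> [d n] [/= mn d0 dm da] [_ _ _ db].
  rewrite -hornerM -hornerN -hornerD; apply: (horner_small (n := n)) => //.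
  - exact: vmax_sub.
  - move=> l ln; rewrite coefB trE ln -rmorphM /= coef_map.
    by rewrite coef_ps_truncM // subrr.
  move=> l; rewrite coefB mulrBr trE; case: ifP => [ln|_].
    rewrite -rmorphM /= coef_map.
    by rewrite coef_ps_truncM // subrr rpred0.
  rewrite mulr0 sub0r rpredN coefM mulr_sumr rpred_sum // => j _.
  rewrite expr2 mulrACA !trE; apply: rpredM.
    by case: ifP => [/da /vmax_sub //|_]; rewrite mulr0 rpred0.
  by case: ifP => [/db /vmax_sub //|_]; rewrite mulr0 rpred0.
have th0 a : a != 0 -> theta a \notin vmax W.
  move=> /ps_neq0 h; case: (ex_minnP h) => m am mmin; apply/negP => /WmP/(_ m.+1).
  rewrite -uclsX -uclsV -uclsM => /uvalP aU; set s := pscoef a m in am.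
  (* Divided by its leading term sigma(s) d^m, the truncation is 1 plus terms with a factor d
     sigma(a_j / s), hence congruent to 1. If theta(a) were divisible by c^(m+1), the same quotient
     would be infinitesimal, because d sigma(s^-1) is. *)
  have [[d n]] := filter_ex (filterI aU (filterI (good (fun j => pscoef a j / s) m.+1)
    (good (fun=> s^-1) m.+1))).
  case=> /= av [[/= mn d0 dm da] [_ _ _ /= ds]].
  have s0 : sigma s != 0 by rewrite fmorph_eq0.
  have /negP[] := vmax1 v.
  rewrite -(vmax_congr (x := (tr n a).[d] / d ^+ m.+1 * (d * sigma s^-1))).
    by apply: vmaxMl => //; apply: (ds 0%N); apply: leq_trans mn.
  have -> : (tr n a).[d] / d ^+ m.+1 * (d * sigma s^-1) = (tr n a).[d] / (d ^+ m * sigma s).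
    rewrite fmorphV exprS; move: (expf_neq0 m d0) (tr n a).[d] s0 => + A.
    by move: (d ^+ m) (sigma s) => D S D0 S0; field; rewrite ?S0 ?d0 ?D0.
  rewrite (horner_coef_wide _ (str n a)) (bigD1 (Ordinal mn)) //= trE mn mulrDl -/s.
  rewrite [sigma s * _]mulrC divff ?mulf_neq0 ?expf_neq0 // addrAC subrr add0r.
  rewrite mulr_suml rpred_sum // => j jm; rewrite trE ltn_ord.
  have [jltm|] := ltnP j m.
    have -> : pscoef a j = 0 by apply/eqP; apply: contraTT jltm => /mmin; rewrite -leqNgt.
    by rewrite rmorph0 !mul0r vmax0.
  rewrite leq_eqVlt eq_sym -[_ == _]/(j == Ordinal mn) (negPf jm) /= => mj.
  have -> : sigma (pscoef a j) * d ^+ j / (d ^+ m * sigma s) =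
      d * sigma (pscoef a j / s) * d ^+ (j - m.+1).
    rewrite fmorph_div (_ : d ^+ j = d ^+ m * d * d ^+ (j - m.+1)); last first.
      by rewrite -exprSr -exprD subnKC.
    move: (expf_neq0 m d0) s0; move: (d ^+ m) (d ^+ _) (sigma s) (sigma _) => D D' S A D0 S0.
    by field; rewrite ?S0 ?D0.
  by apply: vmaxMr; [rewrite rpredX // vmax_sub | apply: da].
have cst n : ucls UU (fun=> n%:R : K) = n%:R.
  elim: n => [|n IH]; first exact: ucls0.
  transitivity (ucls UU (fun=> n%:R : K) + ucls UU (fun=> 1)).
    by rewrite -uclsD; congr ucls; apply/funext => i; rewrite natr1.
  by rewrite IH ucls1 natr1.
(* A natural number nonzero in [F] is a nonzero power series, so [theta] keeps it out of the maximal
   ideal; one that is zero in [F] is zero in [K] through [sigma]. *)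
have Wchar (n : nat) : n%:R \in vmax W -> n%:R = 0 :> KU.
  rewrite -(vmax_congr (residual_nat n th)); have [n0|n0] := eqVneq (n%:R : F) 0.
    by move=> _; rewrite -cst -(ucls0 K UU) -(rmorph_nat sigma) n0 rmorph0.
  have : n%:R != 0 :> power_series F; last by move/th0/negPf => ->.
  have psn : pscoef (n%:R : power_series F) 0 = n%:R.
    by elim: (n) => // k IH; rewrite -!natr1 -IH.
  by apply: contraNneq n0 => n0; rewrite -psn n0.
have [theta' th'] := residual_fraction th th0.
rewrite (elem_equiv_Th_ex (upow_elem_equiv K UU)).
apply: (Th_ex_residual Wchar th') => f a fW aW fa f'a.
apply: (hensel_lift (v := vU)) => //; exact: uval_hensel.
Qed.

End LaurentTransfer.

(** * Power series and Weierstrass factorization *)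

(** Course-of-values recursion: [G n] consults only values below n, which the auxiliary list [s n]
    stores. *)
Lemma strong_recursion (T : Type) (d : T) (G : nat -> (nat -> T) -> T) :
  (forall n f g, (forall i, (i < n)%N -> f i = g i) -> G n f = G n g) ->
  exists f, forall n, f n = G n f.
Proof.
move=> Gext; pose s := fix s n := if n is m.+1 then rcons (s m) (G m (nth d (s m))) else [::].
have ss n : size (s n) = n by elim: n => //= n IH; rewrite size_rcons IH.
have sn n i : (i < n)%N -> nth d (s n) i = nth d (s i.+1) i.
  elim: n => // n IH; rewrite ltnS leq_eqVlt => /predU1P[->//|/[dup] ltin /IH <-].
  by rewrite /= nth_rcons ss ltin.
exists (fun n => nth d (s n.+1) n) => n.
by rewrite /= nth_rcons ss ltnn eqxx; apply: Gext => i /sn.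
Qed.

Section PowerSeriesFacts.

Variable F : fieldType.
Implicit Types a b : power_series F.

Lemma pscoef_sum (J : Type) (r : seq J) (P : pred J) (f : J -> power_series F) n :
  pscoef (\sum_(j <- r | P j) f j) n = \sum_(j <- r | P j) pscoef (f j) n.
Proof. exact: (big_morph (fun a => pscoef a n)). Qed.

Lemma pscoefM a b n : pscoef (a * b) n = \sum_(i < n.+1) pscoef a i * pscoef b (n - i)%N.
Proof. by []. Qed.

Lemma pscoefM0 a b : pscoef (a * b) 0 = pscoef a 0 * pscoef b 0.
Proof. by rewrite pscoefM big_ord1. Qed.

Lemma ps_inv_exists a : pscoef a 0 != 0 -> exists b, a * b = 1.
Proof.
move=> a0.
pose G n (f : nat -> F) := (pscoef a 0)^-1 *
  ((n == 0)%N%:R - \sum_(i < n) pscoef a i.+1 * f (n - i.+1)%N).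
have [|f fE] := @strong_recursion F 0 G.
  move=> n f g fg; congr (_ * (_ - _)); apply: eq_bigr => i _; rewrite fg //.
  by rewrite ltn_subrL (leq_ltn_trans _ (ltn_ord i)).
exists (PowerSeries f); apply: psP => n; rewrite pscoefM big_ord_recl /= subn0.
by rewrite {1}fE mulrA divff // mul1r subrK.
Qed.

Definition ps_shift m a := PowerSeries (fun n => pscoef a (n + m)).

Definition ps_X m : power_series F := PowerSeries (fun n => (n == m)%:R).

Lemma pscoef_XM m a n : pscoef (ps_X m * a) n = if (n < m)%N then 0 else pscoef a (n - m).
Proof.
rewrite pscoefM; case: ltnP => nm.
  rewrite big1 // => i _ /=; rewrite ltn_eqF ?mul0r //.
  exact: leq_trans (ltn_ord i) nm.
have mn : (m < n.+1)%N by [].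
rewrite (bigD1 (Ordinal mn)) //= eqxx mul1r big1 ?addr0 // => i im.
by rewrite -[(i : nat) == m]/(i == Ordinal mn) (negPf im) mul0r.
Qed.

Lemma ps_shiftK m a : (forall i, (i < m)%N -> pscoef a i = 0) -> a = ps_X m * ps_shift m a.
Proof.
move=> am; apply: psP => n; rewrite pscoef_XM; case: ltnP => [/am //|mn] /=.
by rewrite subnK.
Qed.

Lemma ps_order a : a != 0 -> exists m b, pscoef b 0 != 0 /\ a = ps_X m * b.
Proof.
move=> a0; case: (ex_minnP (ps_neq0 a0)) => m am mmin; exists m, (ps_shift m a); split => //=.
by apply: ps_shiftK => i im; apply/eqP; apply: contraTT im => /mmin; rewrite -leqNgt.
Qed.

Lemma ps_XD m n : ps_X (m + n) = ps_X m * ps_X n.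
Proof.
apply: psP => i; rewrite pscoef_XM /=; case: ltnP => im.
  by rewrite ltn_eqF // ltn_addr.
by congr (nat_of_bool _)%:R; apply/eqP/eqP; lia.
Qed.

Lemma ps_X_neq0 m : ps_X m != 0.
Proof.
apply/eqP => /(congr1 (fun a => pscoef a m)) /= /eqP.
by rewrite eqxx oner_eq0.
Qed.

(* Polynomial form of Weierstrass preparation, solving for [g] and [h] modulo
   increasing powers of the variable by Euclidean division by the reduction of [f]. *)
Lemma weierstrass_factor (f : {poly power_series F}) n r :
  (size f <= n.+1)%N -> (r <= n)%N -> pscoef f`_r 0 != 0 ->
  (forall i, (r < i)%N -> pscoef f`_i 0 = 0) ->
  exists g h : {poly power_series F},
    [/\ f = g * h, (size g <= r.+1)%N & (size h <= (n - r).+1)%N].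
Proof.
move=> sf rn fr ft; pose fc k : {poly F} := \poly_(j < n.+1) pscoef f`_j k.
have fcE k j : (fc k)`_j = pscoef f`_j k.
  rewrite coef_poly; case: ltnP => // nj.
  by rewrite (nth_default _ (leq_trans sf nj)).
have sfc k : (size (fc k) <= n.+1)%N by apply: size_poly.
pose q := fc 0%N; have sq : size q = r.+1.
  apply/eqP; rewrite eqn_leq; apply/andP; split.
    by apply/leq_sizeP => j rj; rewrite fcE ft.
  by rewrite ltnNge; apply: contra fr => /leq_sizeP/(_ r (leqnn r)); rewrite fcE => ->.
have q0 : q != 0 by rewrite -size_poly_eq0 sq.
(* Let g_k, h_k be the coefficients of t^k in [g] and [h], with g_0 = q and h_0 = 1. Comparing
   coefficients of t^k in f = g h leaves err_k = g_k + q h_k, so remainder and quotient by [q] solve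
   it within the size bounds. *)
pose err k (u : nat -> {poly F} * {poly F}) :=
  fc k - \sum_(i < k.-1) (u i.+1).1 * (u (k - i.+1)%N).2.
pose G k u := if k is 0 then (q, 1) else (err k u %% q, err k u %/ q).
have [|u uE] := strong_recursion (0, 0) (G := G).
  case=> // k u u' uu'; rewrite /G; suff -> : err k.+1 u = err k.+1 u' by [].
  congr (_ - _); apply: eq_bigr => i _; have := ltn_ord i => /= ik.
  by rewrite !uu' //; lia.
have su k : (size (u k).1 <= r.+1)%N /\ (size (u k).2 <= (n - r).+1)%N.
  elim/ltn_ind: k => k IH; rewrite uE; case: k IH => [|k] IH /=.
    by rewrite sq size_poly1.
  have serr : (size (err k.+1 u) <= n.+1)%N.
    rewrite (leq_trans (size_polyD _ _)) // size_polyN geq_max sfc /=.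
    apply: (leq_trans (size_sum _ _ _)); apply/bigmax_leqP => i _.
    have ik := ltn_ord i; rewrite /= in ik.
    have [s1 _] := IH i.+1 ik; have [|_ s2] := IH (k.+1 - i.+1)%N.
      by lia.
    apply: leq_trans (size_polyMleq _ _) _; apply: (@leq_trans (r.+1 + (n - r).+1).-1); last by lia.
    by rewrite -!subn1 leq_sub2r // leq_add.
  split; first by have := ltn_modpN0 (err k.+1 u) q0; rewrite sq ltnS => /leqW.
  by rewrite size_divp // sq /= -subSn // leq_sub2r.
have uf k : \sum_(i < k.+1) (u i).1 * (u (k - i)%N).2 = fc k.
  case: k => [|k]; first by rewrite big_ord1 uE /= mulr1.
  rewrite big_ord_recl big_ord_recr /= subn0 /bump /= !add1n subnn.
  have [-> ->] : u 0%N = (q, 1) /\ u k.+1 = (err k.+1 u %% q, err k.+1 u %/ q).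
    by split; apply: uE.
  rewrite /= mulr1; apply: (canLR (subrK _)); apply/esym.
  rewrite opprD addrA -[X in X - _]/(err k.+1 u).
  by rewrite {1}(divp_eq (err k.+1 u) q) addrK mulrC.
pose g : {poly power_series F} := \poly_(j < r.+1) PowerSeries (fun k => (u k).1`_j).
pose h : {poly power_series F} := \poly_(j < (n - r).+1) PowerSeries (fun k => (u k).2`_j).
have gE j k : pscoef g`_j k = (u k).1`_j.
  rewrite coef_poly; case: ltnP => // rj.
  by rewrite nth_default // (leq_trans _ rj) //; have [] := su k.
have hE j k : pscoef h`_j k = (u k).2`_j.
  rewrite coef_poly; case: ltnP => // rj.
  by rewrite nth_default // (leq_trans _ rj) //; have [] := su k.
exists g, h; split; rewrite ?size_poly //.
apply/polyP => j; apply: psP => k; rewrite coefM pscoef_sum -fcE -uf coef_sum.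
under [LHS]eq_bigr do rewrite coefM.
rewrite exchange_big; apply: eq_bigr => a _; rewrite pscoefM.
by apply: eq_bigr => i _; rewrite gE hE.
Qed.

Lemma primitive_part (f : {poly power_series F}) : f != 0 ->
  exists m f', [/\ f = ps_X m *: f', size f' = size f & exists i, pscoef f'`_i 0 != 0].
Proof.
move=> f0; have h : exists m, `[< exists i, pscoef f`_i m != 0 >].
  rewrite -lead_coef_eq0 in f0; have [m fm] := ps_neq0 f0.
  by exists m; apply/asboolP; exists (size f).-1.
case: (ex_minnP h) => m /asboolP[i fi] mmin.
pose f' := \poly_(j < size f) ps_shift m f`_j.
have fj j : ps_X m * f'`_j = f`_j.
  rewrite coef_poly; case: ltnP => sj; last by rewrite mulr0 nth_default.
  rewrite -ps_shiftK // => k km; apply/eqP; apply: contraTT km => fk.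
  by rewrite -leqNgt mmin //; apply/asboolP; exists j.
have E : f = ps_X m *: f' by apply/polyP => j; rewrite coefZ fj.
exists m, f'; split=> //.
  by rewrite [in RHS]E size_scale // ps_X_neq0.
by exists i; move: fi; rewrite -fj pscoef_XM ltnn subnn.
Qed.

End PowerSeriesFacts.

(** * Laurent series fields are henselian *)

Lemma clear_denominators (R : idomainType) (p : {poly {fraction R}}) :
  exists b (f : {poly R}), b != 0 /\ map_poly (@tofrac R) f = tofrac b *: p.
Proof.
elim/poly_ind: p => [|p c [b [f [b0 E]]]].
  by exists 1, 0; rewrite oner_neq0 rmorph0 scaler0.
have [a [d [d0 ->]]] := fraction_repr c.
exists (b * d), (d *: (f * 'X) + (a * b)%:P); split; first exact: mulf_neq0.
rewrite rmorphD /= map_polyZ rmorphM /= map_polyX map_polyC E scalerDr.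
rewrite -scalerAl scalerA -tofracM mulrC; congr (_ + _).
rewrite -mul_polyC -polyCM !tofracM; congr _%:P.
by rewrite mulrACA divff ?tofrac_eq0 // mulr1 mulrC; apply: tofracM.
Qed.

(** * Integral elements and valuation rings of finite extensions *)

Section Integral.

Variables (R : comNzRingType) (L : fieldType) (rho : {rmorphism R -> L}).

(** Valuation rings are integrally closed: for x outside [w], dividing the equation by the top power
    of x would put 1 in the maximal ideal. *)
Lemma integral_mem (w : valuation_ring L) x :
  (forall a, rho a \in w) -> integralOver rho x -> x \in w.
Proof.
move=> rw [p pm /rootP px]; apply: contraT => /[dup] xw /notin_vr_inv xm.
have x0 : x != 0 by apply: contraNneq xw => ->; apply: rpred0.
have /negP[] := vmax1 w; have xVw := vmax_sub xm.
have sp : (size (map_poly rho p) <= (size p).-1.+1)%N.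
  by rewrite (leq_trans (size_poly _ _)) // leqSpred.
move: px; rewrite (horner_coef_wide _ sp) big_ord_recr /= !coef_map /=.
rewrite -[p`_(size p).-1]/(lead_coef p) (monicP pm) rmorph1 mul1r.
set n := (size p).-1 => /(congr1 (fun y => y * x^-1 ^+ n)).
rewrite mul0r mulrDl -exprMn divff // expr1n => /eqP; rewrite addrC addr_eq0 => /eqP ->.
rewrite rpredN mulr_suml rpred_sum // => i _; rewrite coef_map /= -mulrA.
apply: vmaxMl => //; have -> : x^-1 ^+ n = x^-1 ^+ i * x^-1 * x^-1 ^+ (n - i.+1).
  by rewrite -exprSr -exprD subnKC.
rewrite -mulrA mulrA -exprMn divff // expr1n mul1r.
by apply: vmaxMr => //; apply: rpredX.
Qed.

(* If [y] were a unit of [w'] lying in the maximal ideal of [w], the integral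
   equation of [y], divided by the power of [y] with the lowest unit coefficient,
   would put that coefficient into the maximal ideal. *)
Lemma integral_vr_max (w w' : valuation_ring L) y :
  (forall a, rho a \in w) -> {subset w <= w'} ->
  (forall a, (rho a \in vmax w') = (rho a \in vmax w)) ->
  integralOver rho y -> y \in vmax w -> y \in vmax w'.
Proof.
move=> rw ww' rm [p pm /rootP py] ym; apply: contraT => ym'.
have yw := vmax_sub ym.
have exj : exists j, rho p`_j \notin vmax w'.
  by exists (size p).-1; rewrite -[p`_ _]/(lead_coef p) (monicP pm) rmorph1 vmax1.
case: (ex_minnP exj) => j pj jmin; case/negP: (pj).
have [jp|] := ltnP j (size p); last by move=> sj; rewrite nth_default // rmorph0 vmax0.
pose z := \sum_(i < size p - j) rho p`_(j + i) * y ^+ i.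
have : y ^+ j * z \in vmax w'.
  have : \sum_(i < size p) rho p`_i * y ^+ i = 0.
    rewrite -[RHS]py (horner_coef_wide _ (size_poly _ _)); apply: eq_bigr => i _.
    by rewrite coef_map.
  rewrite -(big_mkord xpredT (fun i => rho p`_i * y ^+ i)) (big_cat_nat (n := j)) //=; last exact: ltnW.
  rewrite addrC => /eqP; rewrite addr_eq0 => /eqP E.
  have -> : y ^+ j * z = \sum_(j <= i < size p) rho p`_i * y ^+ i.
    rewrite -{2}[j]add0n big_addn big_mkord mulr_sumr; apply: eq_bigr => i _.
    by rewrite [(i + j)%N]addnC exprD mulrCA.
  rewrite E rpredN big_mkord rpred_sum // => i _; apply: vmaxMr.
    by rewrite rpredX // ww'.
  by apply: contraT => /jmin; rewrite leqNgt ltn_ord.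
move=> /vmax_prime; rewrite rpredX ?ww' // => /(_ isT)/orP[/vmaxX yj|].
  by rewrite yj ?ww' in ym'.
move/(vmax_subset ww'); rewrite /z.
have [n ->] : exists n, (size p - j = n.+1)%N by exists (size p - j).-1; rewrite prednK // subn_gt0.
rewrite big_ord_recl mulr1 addn0 rm rpredDr //.
rewrite rpred_sum // => i _; apply: vmaxMl => //.
exact: vmax_exp.
Qed.

End Integral.

Section IntegralOrInverse.

Variables (F K : fieldType).
Local Notation R := (power_series F).
Variables (tau : {rmorphism R -> K}) (L : fieldExtType K).
Hypothesis tau_eq0 : forall a, (tau a == 0) = (a == 0).
Hypothesis denominators : forall p : {poly K}, exists b (f : {poly R}),
  b != 0 /\ map_poly tau f = tau b *: p.

Definition ext_map (a : R) : L := in_alg L (tau a).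
HB.instance Definition _ := GRing.RMorphism.copy ext_map (in_alg L \o tau).

Lemma ext_map_eq0 a : (ext_map a == 0) = (a == 0).
Proof. by rewrite /ext_map fmorph_eq0 tau_eq0. Qed.

Lemma integral_scale (p : {poly R}) x : pscoef (lead_coef p) 0 != 0 ->
  root (map_poly ext_map p) x -> integralOver ext_map x.
Proof.
move=> /ps_inv_exists[b pb] px; exists (b *: p).
  by rewrite monicE lead_coefZ mulrC pb.
by rewrite map_polyZ /root hornerZ (rootP px) mulr0.
Qed.

(** The hypotheses make [K] the fraction field of F[[t]]. Take a primitive polynomial of least
    degree n killing x, and let r be the last index of a unit coefficient. If 0 < r < n, Weierstrass
    factorization splits it into factors of smaller degree, one of which kills x. So r = n and x is
    integral, or r = 0 and x^-1 is. *)
Lemma integral_or_inv (x : L) : x != 0 ->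
  integralOver ext_map x \/ integralOver ext_map x^-1.
Proof.
move=> x0; pose P n := `[< exists f : {poly R},
  [/\ f != 0, root (map_poly ext_map f) x & size f = n] >].
have exP : exists n, P n.
  have /polyOver1P[q qx] := minPolyOver 1%AS x.
  have [b [f [b0 E]]] := denominators q.
  have xf : map_poly ext_map f = map_poly (in_alg L) (map_poly tau f).
    by rewrite -map_poly_comp.
  exists (size f); apply/asboolP; exists f; split=> //.
    have : map_poly (in_alg L) (map_poly tau f) != 0.
      rewrite E map_polyZ -qx scaler_eq0 fmorph_eq0 tau_eq0 (negPf b0).
      by rewrite monic_neq0 ?monic_minPoly.
    by apply: contraNneq => ->; rewrite !rmorph0.
  by rewrite xf E map_polyZ -qx /root hornerZ (rootP (root_minPoly _ _)) mulr0.
case: (ex_minnP exP) => s /asboolP[f0 [f0n f0x f0s]] smin.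
have [m [f [f0E sf [i0 fi0]]]] := primitive_part f0n.
have fn : f != 0 by rewrite -size_poly_eq0 sf size_poly_eq0.
have fx : root (map_poly ext_map f) x.
  move: f0x; rewrite f0E map_polyZ rootZ // ext_map_eq0.
  exact: ps_X_neq0.
rewrite f0s in sf; move: sf smin {exP f0 f0n f0x f0s f0E}.
case: s => [/eqP|n sf smin]; first by rewrite size_poly_eq0 (negPf fn).
have fbound i : pscoef f`_i 0 != 0 -> (i <= n)%N.
  by apply: contraNT; rewrite -ltnNge => ni; rewrite nth_default ?sf.
case: (ex_maxnP (ex_intro _ i0 fi0) fbound) => r fr rmax.
have rn := fbound r fr.
have [rE|rneq] := eqVneq r n.
  by left; apply: integral_scale fx; rewrite lead_coefE sf -rE.
have [r0|r0] := posnP r.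
  rewrite r0 in fr; right; pose p := \poly_(i < n.+1) f`_(n - i).
  have lp : lead_coef p = f`_0.
    rewrite lead_coef_poly //= ?subnn //; apply: contraNneq fr => ->.
    by rewrite eqxx.
  apply: (@integral_scale p); first by rewrite lp.
  have sp : (size (map_poly ext_map p) <= n.+1)%N.
    by rewrite (leq_trans (size_poly _ _)) // size_poly.
  have sfr : (size (map_poly ext_map f) <= n.+1)%N by rewrite -sf size_poly.
  apply/rootP; rewrite (horner_coef_wide _ sp) (reindex_inj rev_ord_inj) /=.
  transitivity (x^-1 ^+ n * (map_poly ext_map f).[x]); last by rewrite (rootP fx) mulr0.
  rewrite (horner_coef_wide _ sfr) mulr_sumr; apply: eq_bigr => i _.
  have iln : (i <= n)%N by rewrite -ltnS.
  rewrite !coef_map /= coef_poly subSS ltnS leq_subr subKn // mulrCA; congr (_ * _).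
  have -> : x^-1 ^+ n = x^-1 ^+ (n - i) * x^-1 ^+ i by rewrite -exprD subnK.
  by rewrite -mulrA -exprMn mulVf // expr1n mulr1.
have sfn : (size f <= n.+1)%N by rewrite sf.
have ft i : (r < i)%N -> pscoef f`_i 0 = 0.
  by move=> ri; apply/eqP; apply: contraTT ri => /rmax; rewrite -leqNgt.
have [g [h [fgh sg sh]]] := weierstrass_factor sfn rn fr ft.
have small (p : {poly R}) : p != 0 -> (size p < n.+1)%N -> ~~ root (map_poly ext_map p) x.
  move=> p0 sp; apply/negP => px; have : P (size p) by apply/asboolP; exists p.
  by move/smin; rewrite leqNgt sp.
have rltn : (r < n)%N by rewrite ltn_neqAle rneq.
move: fx fn; rewrite fgh rmorphM rootM mulf_eq0 negb_or => /orP[gx|hx] /andP[g0 h0].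
  by have := small g g0 (@leq_ltn_trans r.+1 _ n.+1 sg rltn); rewrite gx.
have hn : ((n - r).+1 < n.+1)%N by lia.
by have := small h h0 (leq_ltn_trans sh hn); rewrite hx.
Qed.

Lemma integral_descends x : integralOver ext_map x%:A -> integralOver tau x.
Proof.
case=> p pm px; exists p => //; move: px; rewrite -[_%:A]/(in_alg L x).
by rewrite (map_poly_comp (in_alg L) tau) /root horner_map fmorph_eq0.
Qed.

End IntegralOrInverse.

Section LaurentValuation.

Variable F : fieldType.
Local Notation R := (power_series F).
Local Notation K := (laurent_series F).

Definition laurent_vr_mem : {pred K} := [pred x | `[< exists a : R, x = tofrac a >]].

Lemma laurent_memP x : reflect (exists a : R, x = tofrac a) (x \in laurent_vr_mem).
Proof. exact: asboolP. Qed.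

Fact laurent_vr_subring : subring_closed laurent_vr_mem.
Proof.
split; first by apply/laurent_memP; exists 1; rewrite tofrac1.
  move=> _ _ /laurent_memP[a ->] /laurent_memP[b ->]; apply/laurent_memP.
  by exists (a - b); rewrite tofracB.
move=> _ _ /laurent_memP[a ->] /laurent_memP[b ->]; apply/laurent_memP.
by exists (a * b); rewrite tofracM.
Qed.

Fact laurent_vr_total x : (x \in laurent_vr_mem) || (x^-1 \in laurent_vr_mem).
Proof.
have [a [b [b0 ->]]] := fraction_repr x.
have [->|a0] := eqVneq a 0.
  by rewrite tofrac0 mul0r (introT (laurent_memP _)) //; exists 0; rewrite tofrac0.
have key (c d : R) m n : pscoef d 0 != 0 -> (n <= m)%N ->
    tofrac (ps_X F m * c) / tofrac (ps_X F n * d) \in laurent_vr_mem.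
  move=> d0 nm; have [d' dd'] := ps_inv_exists d0.
  apply/laurent_memP; exists (ps_X F (m - n)%N * c * d').
  have td : tofrac (ps_X F n * d) != 0.
    rewrite tofrac_eq0 mulf_neq0 ?ps_X_neq0 //.
    by apply: contraNneq d0 => ->; rewrite eqxx.
  apply: (canLR (mulfK td)); rewrite -tofracM; congr tofrac.
  by rewrite -{1}(subnK nm) ps_XD mulrACA [d' * d]mulrC dd' mulr1 mulrAC.
have [m [a' [a'0 ->]]] := ps_order a0; have [n [b' [b'0 ->]]] := ps_order b0.
case: (leqP n m) => [nm|/ltnW mn]; first by rewrite (key a' b' m n).
by rewrite invf_div (key b' a' n m) ?orbT.
Qed.

Definition laurent_vr : valuation_ring K := ValuationRing laurent_vr_subring laurent_vr_total.

Lemma laurent_vrP x : reflect (exists a : R, x = tofrac a) (x \in laurent_vr).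
Proof. exact: asboolP. Qed.

Lemma tofrac_laurent_vr (a : R) : (tofrac a : K) \in laurent_vr.
Proof. by apply/laurent_vrP; exists a. Qed.

Lemma tofrac_vmax (a : R) : ((tofrac a : K) \in vmax laurent_vr) = (pscoef a 0 == 0).
Proof.
rewrite vmaxE tofrac_eq0; have [->|a0 /=] := eqVneq a 0; first by rewrite eqxx.
apply/idP/idP; apply: contraTT; rewrite negbK; last move=> /laurent_vrP[b ab].
  move=> ha.
  have [b ab] := ps_inv_exists ha; apply/laurent_vrP; exists b.
  apply: (mulfI (_ : tofrac a != 0)); first by rewrite tofrac_eq0.
  by rewrite divff ?tofrac_eq0 // -tofracM ab tofrac1.
have : a * b = 1.
  by apply/eqP; rewrite -tofrac_eq tofracM tofrac1 -ab divff // tofrac_eq0.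
move=> ab1; have e : pscoef a 0 * pscoef b 0 = 1 by rewrite -pscoefM0 ab1.
by apply: contraNneq (oner_neq0 F) => a00; rewrite -e a00 mul0r.
Qed.

Lemma laurent_nontrivial : nontrivial_vr laurent_vr.
Proof.
exists (tofrac (ps_X F 1))^-1.
by have := tofrac_vmax (ps_X F 1); rewrite vmaxE tofrac_eq0 (negPf (ps_X_neq0 _ _)) eqxx.
Qed.

Section FiniteExtension.

Variable L : fieldExtType K.

Local Notation laurent_ext := (ext_map (@tofrac R) L).

Definition int_closure : {pred L} := [pred x | `[< integralOver laurent_ext x >]].

Lemma int_closureP x : reflect (integralOver laurent_ext x) (x \in int_closure).
Proof. exact: asboolP. Qed.

Fact int_closure_subring : subring_closed int_closure.
Proof.
split; first exact/int_closureP/integral1.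
  by move=> x y /int_closureP ix /int_closureP iy; apply/int_closureP/integral_sub.
by move=> x y /int_closureP ix /int_closureP iy; apply/int_closureP/integral_mul.
Qed.

Fact int_closure_total x : (x \in int_closure) || (x^-1 \in int_closure).
Proof.
have tau0 (a : R) : (tofrac a == 0 :> K) = (a == 0) by exact: tofrac_eq0.
have [->|/(integral_or_inv tau0 (@clear_denominators R))[]] := eqVneq x 0.
- by rewrite (introT (int_closureP _)) //; apply: integral0.
- by move=> /int_closureP ->.
- by move=> /int_closureP ->; rewrite orbT.
Qed.

Definition laurent_ext_vr : valuation_ring L :=
  ValuationRing int_closure_subring int_closure_total.

Lemma laurent_ext_vrP x : reflect (integralOver laurent_ext x) (x \in laurent_ext_vr).
Proof. exact: asboolP. Qed.

Lemma laurent_ext_extends : vr_extends laurent_vr laurent_ext_vr.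
Proof.
move=> x; apply/laurent_ext_vrP/idP => [|/laurent_vrP[a ->]]; last exact: integral_id.
by move/integral_descends; apply: integral_mem; apply: tofrac_laurent_vr.
Qed.

(** [w] contains the integral closure. If x in [w] were not integral, x^-1 would be integral and in
    the maximal ideal of the closure, hence in that of [w] by [integral_vr_max]. *)
Lemma laurent_ext_unique (w : valuation_ring L) :
  vr_extends laurent_vr w -> w =i laurent_ext_vr.
Proof.
move=> vw; have rw a : laurent_ext a \in w.
  by rewrite /ext_map /= vw tofrac_laurent_vr.
have sub : {subset laurent_ext_vr <= w}.
  by move=> x /laurent_ext_vrP; apply: integral_mem.
have rm a : (laurent_ext a \in vmax w) = (laurent_ext a \in vmax laurent_ext_vr).
  by rewrite (vmax_extends _ vw) (vmax_extends _ laurent_ext_extends).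
have rw' a : laurent_ext a \in laurent_ext_vr by apply/laurent_ext_vrP/integral_id.
move=> x; apply/idP/idP; last exact: sub.
move=> xw; apply: contraT => /[dup] xn /notin_vr_inv ym.
have x0 : x != 0 by apply: contraNneq xn => ->; apply: rpred0.
have /laurent_ext_vrP iy := vmax_sub ym.
by have := integral_vr_max rw' sub rm iy ym; rewrite (negPf (notin_vmaxV xw x0)).
Qed.

End FiniteExtension.

Lemma laurent_henselian : henselian_vr laurent_vr.
Proof.
move=> L; exists (laurent_ext_vr L); split; first exact: laurent_ext_extends.
exact: laurent_ext_unique.
Qed.

End LaurentValuation.

(** * The equivalences *)

Section EmbeddedField.

Variables (E k : fieldType) (g : {rmorphism E -> k}).

(** A copy of [E] whose type remembers [g]: subfields in [Z_large_class] are subtypes, and this lets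
    an abstract embedding act as one. *)
Definition embedded : Type := (fun=> E : Type) g.

HB.instance Definition _ := GRing.Field.on embedded.

Definition embedded_pred : pred k := fun y => `[< exists x, g x = y >].

Definition embedded_val : embedded -> k := g.

Definition embedded_Sub y (Py : embedded_pred y) : embedded := sval (cid (asboolW Py)).

Fact embedded_SubK y Py : embedded_val (@embedded_Sub y Py) = y.
Proof. exact: svalP (cid (asboolW Py)). Qed.

Fact embedded_rect (T : embedded -> Type) :
  (forall y Py, T (@embedded_Sub y Py)) -> forall x, T x.
Proof.
move=> TS x; have Px : embedded_pred (embedded_val x) by apply/asboolP; exists x.
suff <- : embedded_Sub Px = x by [].
exact: fmorph_inj (embedded_SubK Px).
Qed.

HB.instance Definition _ :=
  isSub.Build k embedded_pred embedded embedded_rect embedded_SubK.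

Fact embedded_val_zmod : zmod_morphism (val : embedded -> k).
Proof. exact: rmorphB g. Qed.
Fact embedded_val_monoid : monoid_morphism (val : embedded -> k).
Proof. by split; [exact: rmorph1 g | exact: rmorphM g]. Qed.

HB.instance Definition _ :=
  GRing.isSubZmodule.Build k embedded_pred embedded embedded_val_zmod.
HB.instance Definition _ :=
  GRing.isSubPzSemiRing.Build k embedded_pred embedded embedded_val_monoid.

End EmbeddedField.

Section LaurentResidue.

Variable F : fieldType.
Local Notation K := (laurent_series F).

Definition ps_const (x : F) : power_series F := PowerSeries (fun n => if n is 0 then x else 0).

Fact ps_const_zmod : zmod_morphism ps_const.
Proof. by move=> x y; apply: psP => -[|n] //=; rewrite subr0. Qed.

Fact ps_const_monoid : monoid_morphism ps_const.
Proof.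
split=> [|x y]; first by apply: psP => -[|n].
apply: psP => -[|n]; rewrite pscoefM; first by rewrite big_ord1.
by rewrite big1 // => -[[|i] ip] _ /=; rewrite ?mulr0 ?mul0r.
Qed.

HB.instance Definition _ := GRing.isZmodMorphism.Build F (power_series F) ps_const ps_const_zmod.
HB.instance Definition _ := GRing.isMonoidMorphism.Build F (power_series F) ps_const ps_const_monoid.

Definition laurent_const : {rmorphism F -> K} := (@tofrac (power_series F)) \o ps_const.

Local Notation v := (laurent_vr F).

Definition laurent_residue (x : F) : residue_field v :=
  residue (VrElt (tofrac_laurent_vr (ps_const x))).

Lemma residue_vmax (L : fieldType) (w : valuation_ring L) (x y : vr_elt w) :
  residue x = residue y <-> vr_val x - vr_val y \in vmax w.
Proof.
rewrite -[vr_val x - vr_val y]/(vr_val (x - y)) vmax_max_ideal Quotient.idealrBE.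
by split=> /eqP.
Qed.

Fact laurent_residue_zmod : zmod_morphism laurent_residue.
Proof.
move=> x y; rewrite /laurent_residue -rmorphB; congr residue; apply/val_inj => /=.
by rewrite rmorphB tofracB.
Qed.

Fact laurent_residue_monoid : monoid_morphism laurent_residue.
Proof.
split=> [|x y].
  by rewrite -[RHS](rmorph1 (@residue _ v)); congr residue; apply/val_inj; rewrite /= rmorph1 tofrac1.
rewrite /laurent_residue -rmorphM; congr residue; apply/val_inj => /=.
by rewrite rmorphM tofracM.
Qed.

HB.instance Definition _ := GRing.isZmodMorphism.Build F (residue_field v)
  laurent_residue laurent_residue_zmod.
HB.instance Definition _ := GRing.isMonoidMorphism.Build F (residue_field v)
  laurent_residue laurent_residue_monoid.

Lemma laurent_residue_surj y : exists x, laurent_residue x = y.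
Proof.
rewrite -[y]residueK; set z := repr _.
have /laurent_vrP[a za] := vr_valP z; exists (pscoef a 0).
by apply/residue_vmax; rewrite za /= -tofracB tofrac_vmax /= subrr.
Qed.

Lemma laurent_residue_isomorphic : field_isomorphic (residue_field v) F.
Proof.
have /choice[h hK] := laurent_residue_surj.
have hB : zmod_morphism h.
  by move=> x y; apply: (fmorph_inj laurent_residue); rewrite rmorphB /= !hK.
have hM : monoid_morphism h.
  split=> [|x y]; apply: (fmorph_inj laurent_residue); first by rewrite rmorph1 /= hK.
  by rewrite rmorphM /= !hK.
exists (HB.pack h (GRing.isZmodMorphism.Build _ _ _ hB)
  (GRing.isMonoidMorphism.Build _ _ _ hM) : {rmorphism residue_field v -> F}).
exists laurent_residue => [x|x] /=; first exact: hK.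
by apply: (fmorph_inj laurent_residue); rewrite /= hK.
Qed.

Lemma laurent_equicharacteristic : equicharacteristic v.
Proof.
by move=> p; rewrite (fmorph_pchar laurent_const) (fmorph_pchar laurent_residue).
Qed.

End LaurentResidue.

Lemma laurent_model (F : fieldType) (T : set ring_sentence) :
  models F T -> HeR_model T (laurent_vr F).
Proof.
move=> FT; split; last first.
  by move=> phi /FT; have := isomorphic_elem_equiv (laurent_residue_isomorphic F) phi; tauto.
split; [exact: laurent_equicharacteristic|exact: laurent_henselian|exact: laurent_nontrivial].
Qed.

Lemma natr_transfer (k K : fieldType) (n : nat) :
  (forall p, p \in [pchar k] -> p \in [pchar K]) -> n%:R = 0 :> k -> n%:R = 0 :> K.
Proof.
move=> kK n0; case: (posnP n) => [->//|n_gt0].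
have [p pk] : exists p, p \in [pchar k] by apply: natf0_pchar n_gt0 _; rewrite n0.
by apply/eqP; rewrite -(dvdn_pcharf (kK _ pk)) (dvdn_pcharf pk) n0.
Qed.

(** The residual map chooses representatives, with [W] equal to [v]; the hypothesis on
    characteristics excludes mixed characteristic. *)
Lemma Th_ex_residue_field (K : fieldType) (v : valuation_ring K) :
  (forall p, p \in [pchar residue_field v] -> p \in [pchar K]) -> henselian_vr v ->
  (Th_ex (residue_field v) `<=` Th_ex K)%classic.
Proof.
move=> vK /henselian_hensel hv.
pose theta (q : residue_field v) : K := vr_val (repr (q : {ideal_quot @max_ideal K v})).
have th : residual_map v theta.
  split.
  - by move=> x; apply: vr_valP.
  - by apply/(residue_vmax _ 1); rewrite residueK; apply/esym/rmorph1.
  - move=> x y; apply/(residue_vmax _ (repr x + repr y)); rewrite residueK.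
    by rewrite -{1}[x]residueK -{1}[y]residueK; apply/esym/rmorphD.
  - move=> x y; apply/(residue_vmax _ (repr x * repr y)); rewrite residueK.
    by rewrite -{1}[x]residueK -{1}[y]residueK; apply/esym/rmorphM.
apply: (Th_ex_residual _ th) => [n nm|f a fv av fa f'a]; last exact: (hensel_lift hv).
apply: (natr_transfer vK); apply/eqP; apply: contraT => /(res_neq0 th).
by rewrite (vmax_congr (residual_nat n th)) nm.
Qed.

Lemma Th_ex_laurent (F K : fieldType) (v : valuation_ring K) :
  (Th_ex F `<=` Th_ex K)%classic -> henselian_vr v -> nontrivial_vr v ->
  (Th_ex (laurent_series F) `<=` Th_ex K)%classic.
Proof.
move=> FK /henselian_hensel hv [x xv].
have [I [U [UU [sigma]]]] := ultrapower_embedding FK.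
rewrite (elem_equiv_Th_ex (upow_elem_equiv K UU)).
apply: (Th_ex_laurent_henselian sigma (v := uval UU v)); first exact: uval_hensel.
exists (ucls UU (fun=> x)); apply/negP => /uvalP/filter_ex[_].
by rewrite (negPf xv).
Qed.

(** Numerals as closed terms make p = 0 a quantifier-free sentence, so existential theories see the
    characteristic. *)
Fixpoint TNat (n : nat) : ring_term 0 :=
  if n is m.+1 then TAdd (TNat m) (TOne 0) else TZero 0.

Lemma eval_TNat (R : nzRingType) (e : 0.-tuple R) n : eval_term e (TNat n) = n%:R.
Proof. by elim: n => //= n ->; rewrite natr1. Qed.

Lemma Th_ex_pchar (k K : fieldType) p :
  (Th_ex k `<=` Th_ex K)%classic -> p \in [pchar k] -> p \in [pchar K].
Proof.
move=> kK /andP[pp /eqP p0]; apply/andP; split=> //; apply/eqP.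
have /kK[] : Th_ex k (FEq (TNat p) (TZero 0)) by split=> //=; rewrite /Th /satisfies /= eval_TNat.
by rewrite /Th /satisfies /= eval_TNat.
Qed.

Lemma Th_ex_sub_laurent (F : fieldType) : (Th_ex F `<=` Th_ex (laurent_series F))%classic.
Proof. exact: Th_ex_rmorphism (laurent_const F). Qed.

Lemma Th_ex_sub_HeR (F : fieldType) : (Th_ex F `<=` HeR_ex (Th_ex F))%classic.
Proof.
move=> phi phiF; split; first by case: phiF.
move=> K v [[ev hv _] /(_ _ phiF) phik].
have vK p : p \in [pchar residue_field v] -> p \in [pchar K] by rewrite ev.
have resphi : Th_ex (residue_field v) phi by split=> //; case: phiF.
by case: (Th_ex_residue_field vK hv resphi).
Qed.

Lemma HeR_ex_anti (T T' : set ring_sentence) :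
  (T `<=` T' -> HeR_ex T `<=` HeR_ex T')%classic.
Proof.
move=> TT' phi [ephi h]; split=> // K v [Kv vT'].
by apply: (h K v); split=> // psi /TT' /vT'.
Qed.

Lemma HeR_ex_laurent (F : fieldType) (T : set ring_sentence) :
  models F T -> (HeR_ex T `<=` Th_ex (laurent_series F))%classic.
Proof. by move=> FT phi [ephi h]; split=> //; apply: (h _ _ (laurent_model FT)). Qed.

(** In any model the sentences of [Th_ex F] pass from the residue field to [K], which meets the
    assumption of [Th_ex_laurent]. With [HeR_ex_laurent] this gives equality for every [F]. *)
Lemma laurent_sub_HeR_ex (F : fieldType) :
  (Th_ex (laurent_series F) `<=` HeR_ex (Th_ex F))%classic.
Proof.
move=> phi phiF; split; first by case: phiF.
move=> K v [[ev hv nv] vF].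
suff FK : (Th_ex F `<=` Th_ex K)%classic by case: (Th_ex_laurent FK hv nv phiF).
apply: subset_trans (Th_ex_residue_field _ hv); last by move=> p; rewrite ev.
by move=> psi psiF; split; [apply: vF | case: psiF].
Qed.

Theorem lemma3p3 (F : fieldType) :
  [<-> (* i   *) Th_ex F = Th_ex (laurent_series F);
       (* ii  *) Th_ex F = HeR_ex (Th F);
       (* iii *) Th_ex F = HeR_ex (Th_ex F);
       (* iv  *) HeR_ex_map (Th_ex_theory F) = Th_ex_theory F;
       (* v   *) exists F' : fieldType, henselian_field F' /\ Th_ex F = Th_ex F';
       (* vi  *) Z_large F;
       (* vii *) Z_large_class (fun F' : fieldType => Th_ex F = Th_ex F')].
Proof.
have ThexTh : (Th_ex F `<=` Th F)%classic by move=> phi [].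
tfae.
- move=> FL; apply/seteqP; split.
    exact: subset_trans (@Th_ex_sub_HeR F) (HeR_ex_anti ThexTh).
  by rewrite FL; apply: HeR_ex_laurent.
- move=> FT; apply/seteqP; split; first exact: Th_ex_sub_HeR.
  by rewrite {2}FT; apply: HeR_ex_anti.
- by move=> FT; apply: eq_exist.
- move=> /(congr1 sval) /= FT; exists (laurent_series F); split.
    by exists (laurent_vr F); split; [exact: laurent_nontrivial|exact: laurent_henselian].
  apply/seteqP; split; first exact: Th_ex_sub_laurent.
  by rewrite -FT; apply: laurent_sub_HeR_ex.
(* The key fact, applied to [F'], puts the existential theory of F((t)) inside that of [F], so
   F((t)) embeds in an ultrapower of [F]. That ultrapower is k1, F((t)) the subfield, and [F] is
   k2. *)
- case=> F' [[v [nv hv]] FF'].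
  have [|I [U [UU [sigma]]]] := @ultrapower_embedding (laurent_series F) F.
    by rewrite [X in (_ `<=` X)%classic]FF'; apply: Th_ex_laurent hv nv; rewrite FF'.
  exists (upow F UU), F; split=> //; first exact: upow_elem_equiv.
  exists (embedded_pred sigma), (embedded sigma), (laurent_vr F).
  split; [exact: laurent_nontrivial|exact: laurent_henselian|exact: laurent_residue_isomorphic].
- case=> k1 [k2 [/elem_equiv_Th_ex Fk1 /elem_equiv_Th_ex Fk2 Ev]].
  by exists k1, k2.
case=> k1 [k2 [Fk1 Fk2 [S [E [v [nv hv vk2]]]]]].
apply/seteqP; split; first exact: Th_ex_sub_laurent.
have vF : Th_ex (residue_field v) = Th_ex F.
  by rewrite Fk2; apply/elem_equiv_Th_ex/isomorphic_elem_equiv.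
have Ek1 : (Th_ex E `<=` Th_ex k1)%classic by apply: (Th_ex_rmorphism (val : {rmorphism E -> k1})).
(* Equal characteristic comes for free: p = 0 in the residue field gives p = 0 in k1, as both share
   the existential theory of [F], and so in the subfield [E]. *)
have FE : (Th_ex F `<=` Th_ex E)%classic.
  rewrite -vF; apply: Th_ex_residue_field hv => p pv.
  rewrite -(fmorph_pchar (val : {rmorphism E -> k1})).
  by apply: Th_ex_pchar pv; rewrite vF Fk1.
rewrite [X in (_ `<=` X)%classic]Fk1.
exact: subset_trans (Th_ex_laurent FE hv nv) Ek1.
Qed.
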